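(* Let $M$ be an $\aleph_0$-saturated o-minimal expansion of a real closed field, and let $G=(M^2,+)$. Then the continuous map $\Lambda:S_G^{\rm ext}(M)\to E(S_G(M))$, $p\mapsto\ell_p$, is not an isomorphism of Ellis semigroups.
   Context: Work in an $|M|^+$-saturated elementary extension $\bar M$ of $M$, and regard $G$ as the definable group $(\bar M^2,+)$ with $G(M)=M^2$. A subset of $M^2$ is externally definable if it equals $Y\cap M^2$ for some $Y\subseteq\bar M^2$ definable with parameters from $\bar M$. $S_G(M)$ is the space of ultrafilters on the algebra $\mathcal A$ of $M$-definable subsets of $M^2$ (2-types over $M$), $S^{\rm ext}_G(M)$ the space of ultrafilters on the algebra $\mathcal B$ of externally definable subsets of $M^2$. For an ultrafilter $q$ and $X$ in its algebra, $d_qX=\{g\in M^2\mid X-g\in q\}$. $S^{\rm ext}_G(M)$ is an Ellis semigroup with $p*q=\{X\in\mathcal B\mid d_qX\in p\}$. $E(S_G(M))$ is the closure in $S_G(M)^{S_G(M)}$ (product topology) of the translation maps $\ell_g(q)=\{X\in\mathcal A\mid X-g\in q\}$, $g\in M^2$, with composition; for $p\in S^{\rm ext}_G(M)$, $\ell_p(q)=\{X\in\mathcal A\mid d_qX\in p\}$. An isomorphism of Ellis semigroups is a bijective continuous semigroup homomorphism. *)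

(* Defs.v *)
From HB Require Import structures.
From mathcomp Require Import all_boot all_order all_algebra.
From mathcomp Require Import all_classical.
From mathcomp Require Import constructive_ereal topology.

Set Implicit Arguments.
Unset Strict Implicit.
Unset Printing Implicit Defensive.

Import Order.TTheory GRing.Theory Num.Theory.
Local Open Scope classical_set_scope.
Local Open Scope ring_scope.

Record language := Language {
  fsym : Type;
  farity : fsym -> nat;
  rsym : Type;
  rarity : rsym -> nat }.

Record structure (L : language) (M : Type) := Structure {
  fint : forall f : fsym L, ('I_(farity f) -> M) -> M;
  rint : forall r : rsym L, ('I_(rarity r) -> M) -> Prop }.

Arguments fint {L M} s f.
Arguments rint {L M} s r.

(** Variables are well-scoped de Bruijn indices: [term L n] and [formula L n]
    have their free variables among 'I_n, and [Ex] binds index 0. *)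
Inductive term (L : language) (n : nat) : Type :=
| Var of 'I_n
| App (f : fsym L) of 'I_(farity f) -> term L n.

Arguments Var {L n}.
Arguments App {L n}.

Inductive formula (L : language) : nat -> Type :=
| Equal n : term L n -> term L n -> formula L n
| Atom n (r : rsym L) : ('I_(rarity r) -> term L n) -> formula L n
| Neg n : formula L n -> formula L n
| Conj n : formula L n -> formula L n -> formula L n
| Ex n : formula L n.+1 -> formula L n.

(** [scons y x] is (y, x_0, ..., x_(n-1)) and [sapp x a] is the concatenation
    (x_0, ..., x_(n-1), a_0, ..., a_(m-1)). *)
Definition scons (T : Type) (n : nat) (y : T) (x : 'I_n -> T) : 'I_n.+1 -> T :=
  fun i => if unlift ord0 i is Some j then x j else y.

Definition sapp (T : Type) (n m : nat) (x : 'I_n -> T) (a : 'I_m -> T) :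
    'I_(n + m) -> T :=
  fun i => match fintype.split i with inl j => x j | inr k => a k end.

Fixpoint eval (L : language) (M : Type) (S : structure L M) (n : nat)
    (x : 'I_n -> M) (t : term L n) : M :=
  match t with
  | Var i => x i
  | App f a => fint S f (fun i => eval S x (a i))
  end.

Fixpoint sat (L : language) (M : Type) (S : structure L M) (n : nat)
    (phi : formula L n) : ('I_n -> M) -> Prop :=
  match phi with
  | Equal _ s t => fun x => eval S x s = eval S x t
  | Atom _ r a => fun x => rint S r (fun i => eval S x (a i))
  | Neg _ psi => fun x => ~ sat S psi x
  | Conj _ psi chi => fun x => sat S psi x /\ sat S chi x
  | Ex _ psi => fun x => exists y, sat S psi (scons y x)
  end.

(** Formulas in n variables with finitely many parameters from M. *)
Record pformula (L : language) (M : Type) (n : nat) := PFormula {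
  npar : nat;
  body : formula L (n + npar);
  par : 'I_npar -> M }.

Arguments PFormula {L M n}.
Arguments par {L M n} p i.

Definition psat (L : language) (M : Type) (S : structure L M) (n : nat)
    (phi : pformula L M n) (x : 'I_n -> M) : Prop :=
  sat S (body phi) (sapp x (par phi)).

Definition over (L : language) (M : Type) (A : set M) (n : nat)
    (phi : pformula L M n) : Prop := forall i, A (par phi i).

Definition definable (L : language) (M : Type) (S : structure L M) (A : set M)
    (n : nat) : set (set ('I_n -> M)) :=
  [set X | exists2 phi : pformula L M n, over A phi & X = [set x | psat S phi x]].

(** Every partial n-type over a parameter set A with [small A], finitely
    satisfiable in M, is realized in M.  With [small A] meaning |A| < kappa,
    this is kappa-saturation. *)
Definition saturated (L : language) (M : Type) (S : structure L M)
    (small : set (set M)) : Prop :=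
  forall (A : set M) (n : nat) (Gamma : set (pformula L M n)),
    small A ->
    (forall phi, Gamma phi -> over A phi) ->
    (forall (k : nat) (phi : 'I_k -> pformula L M n),
       (forall i, Gamma (phi i)) -> exists x, forall i, psat S (phi i) x) ->
    exists x, forall phi, Gamma phi -> psat S phi x.

Definition aleph0_saturated (L : language) (M : Type) (S : structure L M) :=
  saturated S (@finite_set M).

(** The bound |A| <= |M| on parameter sets expresses |A| < |M|^+. *)
Record saturated_extension (L : language) (M : Type) (S : structure L M) :=
  SaturatedExtension {
    ext_dom :> Type;
    ext_str : structure L ext_dom;
    emb : M -> ext_dom;
    emb_elementary : forall (n : nat) (phi : formula L n) (x : 'I_n -> M),
      sat S phi x <-> sat ext_str phi (emb \o x);
    ext_saturated : saturated ext_str [set A | (A #<= [set: M])%card] }.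

Arguments ext_str {L M S} s.
Arguments emb {L M S} s.

Variant oring_fun := FZero | FOne | FAdd | FOpp | FMul.
Variant oring_rel := RLt.

Definition oring_farity (f : oring_fun) : nat :=
  match f with FZero | FOne => 0%N | FOpp => 1%N | FAdd | FMul => 2%N end.

Definition oring_ext (L : language) : language := {|
  fsym := oring_fun + fsym L;
  farity := fun f => match f with inl g => oring_farity g | inr g => farity g end;
  rsym := oring_rel + rsym L;
  rarity := fun r => match r with inl RLt => 2%N | inr s => rarity s end |}.

Definition oring_fint (R : rcfType) (f : oring_fun) :
    ('I_(oring_farity f) -> R) -> R :=
  match f return ('I_(oring_farity f) -> R) -> R with
  | FZero => fun=> 0
  | FOne => fun=> 1
  | FAdd => fun x => x ord0 + x ord_max
  | FOpp => fun x => - x ord0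
  | FMul => fun x => x ord0 * x ord_max
  end.

Definition expansion (L : language) (R : rcfType) (S : structure L R) :
    structure (oring_ext L) R := {|
  fint := fun f : fsym (oring_ext L) =>
    match f return ('I_(@farity (oring_ext L) f) -> R) -> R with
    | inl g => @oring_fint R g
    | inr g => fint S g
    end;
  rint := fun r : rsym (oring_ext L) =>
    match r return ('I_(@rarity (oring_ext L) r) -> R) -> Prop with
    | inl RLt => fun x => x ord0 < x ord_max
    | inr s => rint S s
    end |}.

(** Finite unions of points and of open intervals with endpoints in
    M together with -oo and +oo. *)
Definition o_minimal (L : language) (R : rcfType) (S : structure L R) : Prop :=
  forall X : set ('I_1 -> R), definable S setT X ->
    exists (P : seq R) (J : seq (\bar R * \bar R)),
      X = [set x | x ord0 \in P \/
                   exists2 I, I \in J & (I.1 < (x ord0)%:E < I.2)%E].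

Record is_ultrafilter (T : Type) (C p : set (set T)) : Prop := IsUltrafilter {
  ultra_sub : p `<=` C;
  ultra_setT : p setT;
  ultra_set0 : ~ p set0;
  ultra_setI : forall X Y, p X -> p Y -> p (X `&` Y);
  ultra_up : forall X Y, p X -> C Y -> X `<=` Y -> p Y;
  ultra_or : forall X, C X -> p X \/ p (~` X) }.

Record ultra (T : Type) (C : set (set T)) := Ultra {
  uset : set (set T);
  uset_ultra : is_ultrafilter C uset }.

HB.instance Definition _ (T : Type) (C : set (set T)) := gen_eqMixin (ultra C).
HB.instance Definition _ (T : Type) (C : set (set T)) :=
  gen_choiceMixin (ultra C).

Section ultra_topology.
Variables (T : Type) (C : set (set T)).

Definition ubase (X : set T) : set (ultra C) := [set p | uset p X].

Lemma ubase_cover : \bigcup_(X in C) ubase X = setT.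
Proof.
rewrite -subTset => p _; exists setT => /=; last exact: ultra_setT (uset_ultra p).
exact: ultra_sub (uset_ultra p) _ (ultra_setT (uset_ultra p)).
Qed.

Lemma ubase_join (X Y : set T) (p : ultra C) : C X -> C Y ->
  ubase X p -> ubase Y p ->
  exists Z, [/\ C Z, ubase Z p & ubase Z `<=` ubase X `&` ubase Y].
Proof.
move=> CX CY pX pY; have pXY := ultra_setI (uset_ultra p) pX pY.
exists (X `&` Y); split => //; first exact: ultra_sub (uset_ultra p) _ pXY.
move=> q qXY; split; apply: (ultra_up (uset_ultra q) qXY) => //;
  by move=> x [].
Qed.

HB.instance Definition _ :=
  isBaseTopological.Build (ultra C) ubase_cover ubase_join.

Lemma nbhs_ubase (X : set T) (p : ultra C) :
  C X -> uset p X -> nbhs p (ubase X).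
Proof.
move=> CX pX; rewrite nbhsE; exists (ubase X) => //; split=> //.
exists [set X]; first by move=> _ ->.
by rewrite bigcup_set1.
Qed.

Lemma ultra_cvg (I : Type) (F : set_system I) (f : I -> ultra C) (p : ultra C) :
  Filter F -> (forall X, uset p X -> F (f @^-1` ubase X)) -> f @ F --> p.
Proof.
move=> FF fF A; rewrite nbhsE => -[_ [[D DC <-] [X DX pX]] XA].
by apply: filterS (fF _ pX) => i fiX; apply: XA; exists X.
Qed.

Lemma ultra_inj (p q : ultra C) : uset p = uset q -> p = q.
Proof.
case: p q => [p Up] [q Uq] /= pq; move: Up Uq; rewrite pq => Up Uq.
by congr Ultra; exact: Prop_irrelevance.
Qed.

End ultra_topology.

Lemma ptws_eval_continuous (U : Type) (V : topologicalType) (u : U) :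
  continuous (fun f : {ptws U -> V} => f u).
Proof.
move=> f; have /cvg_sup/(_ u) cf : nbhs f --> f by exact: cvg_id.
move=> A fA; apply: cf.
exact: (@initial_continuous _ _ (fun f : {ptws U -> V} => f u) f A fA).
Qed.

Lemma ptws_cvg (I U : Type) (V : topologicalType) (F : set_system I)
    (f : I -> {ptws U -> V}) (g : {ptws U -> V}) :
  Filter F -> (forall u, f ^~ u @ F --> g u) -> f @ F --> g.
Proof.
move=> FF fg; apply/cvg_sup => u A [_ [[B oB <-] /= Bg] BA].
have FB := fg u B (open_nbhs_nbhs (conj oB Bg)).
by apply: (@filterS _ F _ _ _ _ FB) => i; exact: BA.
Qed.

Fixpoint tshift (L : language) (n : nat) (t : term L n) : term L n.+1 :=
  match t with
  | Var i => Var (lift ord0 i)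
  | App f a => App f (fun i => tshift (a i))
  end.

Fixpoint tsubst (L : language) (n m : nat) (s : 'I_n -> term L m)
    (t : term L n) : term L m :=
  match t with
  | Var i => s i
  | App f a => App f (fun i => tsubst s (a i))
  end.

Fixpoint fsubst (L : language) (n : nat) (phi : formula L n) :
    forall m, ('I_n -> term L m) -> formula L m :=
  match phi with
  | Equal _ t u => fun m s => Equal (tsubst s t) (tsubst s u)
  | Atom _ r a => fun m s => Atom (fun i => tsubst s (a i))
  | Neg _ psi => fun m s => Neg (fsubst psi s)
  | Conj _ psi chi => fun m s => Conj (fsubst psi s) (fsubst chi s)
  | Ex _ psi => fun m s =>
      Ex (fsubst psi (scons (Var ord0) (fun i => tshift (s i))))
  end.

Section substitution.
Variables (L : language) (M : Type) (S : structure L M).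

Lemma scons0 (n : nat) (y : M) (x : 'I_n -> M) : scons y x ord0 = y.
Proof. by rewrite /scons unlift_none. Qed.

Lemma sconsS (n : nat) (y : M) (x : 'I_n -> M) i :
  scons y x (lift ord0 i) = x i.
Proof. by rewrite /scons liftK. Qed.

Lemma sapp_l (n m : nat) (x : 'I_n -> M) (a : 'I_m -> M) i :
  sapp x a (lshift m i) = x i.
Proof. by rewrite /sapp (unsplitK (inl i)). Qed.

Lemma sapp_r (n m : nat) (x : 'I_n -> M) (a : 'I_m -> M) i :
  sapp x a (rshift n i) = a i.
Proof. by rewrite /sapp (unsplitK (inr i)). Qed.

Lemma eval_tshift n (t : term L n) y (x : 'I_n -> M) :
  eval S (scons y x) (tshift t) = eval S x t.
Proof.
elim: t => [i|f a IH] /=; first exact: sconsS.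
by congr (fint S f _); apply: funext => i; exact: IH.
Qed.

Lemma eval_tsubst n m (t : term L n) (s : 'I_n -> term L m) (x : 'I_m -> M) :
  eval S x (tsubst s t) = eval S (fun i => eval S x (s i)) t.
Proof.
elim: t => [i|f a IH] //=.
by congr (fint S f _); apply: funext => i; exact: IH.
Qed.

Lemma sat_fsubst n (phi : formula L n) m (s : 'I_n -> term L m)
    (x : 'I_m -> M) :
  sat S (fsubst phi s) x <-> sat S phi (fun i => eval S x (s i)).
Proof.
elim: phi m s x => {n} [n t u|n r a|n psi IH|n psi IH1 chi IH2|n psi IH] m s x /=.
- by rewrite !eval_tsubst.
- suff -> : (fun i => eval S x (tsubst s (a i))) =
            (fun i => eval S (fun j => eval S x (s j)) (a i)) by [].
  by apply: funext => i; rewrite eval_tsubst.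
- by rewrite IH.
- by rewrite IH1 IH2.
- have E y : (fun i => eval S (scons y x)
        (scons (Var ord0) (fun j => tshift (s j)) i)) =
      scons y (fun i => eval S x (s i)).
    apply: funext => i; rewrite /scons; case: unliftP => [j _|_] /=.
      exact: eval_tshift.
    exact: scons0.
  by split=> -[y]; [move/IH; rewrite E|move=> h]; exists y => //;
    apply/IH; rewrite E.
Qed.

Lemma definableC (A : set M) n (X : set ('I_n -> M)) :
  definable S A X -> definable S A (~` X).
Proof.
case=> -[k phi a] oA ->; exists (PFormula k (Neg phi) a) => //.
Qed.

Lemma definableI (A : set M) n (X Y : set ('I_n -> M)) :
  definable S A X -> definable S A Y -> definable S A (X `&` Y).
Proof.
case=> -[k phi a] /= oa -> [[l psi b] /= ob ->].
pose s1 (i : 'I_(n + k)) : term L (n + (k + l)) :=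
  match fintype.split i with inl j => Var (lshift _ j)
                   | inr j => Var (rshift _ (lshift _ j)) end.
pose s2 (i : 'I_(n + l)) : term L (n + (k + l)) :=
  match fintype.split i with inl j => Var (lshift _ j)
                   | inr j => Var (rshift _ (rshift _ j)) end.
exists (PFormula (k + l) (Conj (fsubst phi s1) (fsubst psi s2)) (sapp a b)).
  by move=> i /=; rewrite /sapp; case: (fintype.split i) => j;
    [exact: oa|exact: ob].
have E1 x : (fun i => eval S (sapp x (sapp a b)) (s1 i)) = sapp x a.
  apply: funext => i; rewrite /s1 [RHS]/sapp; case: (fintype.split i) => j /=.
    by rewrite sapp_l.
  by rewrite sapp_r sapp_l.
have E2 x : (fun i => eval S (sapp x (sapp a b)) (s2 i)) = sapp x b.
  apply: funext => i; rewrite /s2 [RHS]/sapp; case: (fintype.split i) => j /=.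
    by rewrite sapp_l.
  by rewrite sapp_r sapp_r.
rewrite eqEsubset; split=> x; rewrite /psat /= !sat_fsubst E1 E2 //.
Qed.

End substitution.

Section translations.
Variable R : rcfType.
Local Notation G := ('I_2 -> R).

Definition translate (X : set G) (g : G) : set G := [set x - g | x in X].

(** d_q X *)
Definition dset (q : set (set G)) (X : set G) : set G :=
  [set g | q (translate X g)].

Lemma translateE X g : translate X g = [set x | X (x + g)].
Proof.
rewrite eqEsubset; split=> [_ [x Xx <-]|x Xx] /=; first by rewrite subrK.
by exists (x + g) => //; rewrite addrK.
Qed.

Lemma translate_translate X g h :
  translate (translate X g) h = translate X (h + g).
Proof. by rewrite !translateE; apply/funext => x /=; rewrite addrA. Qed.

Lemma ultra_dset (C D : set (set G)) (q : ultra C) (p : set (set G)) :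
  C setT -> (forall X, C X -> C (~` X)) ->
  (forall X Y, C X -> C Y -> C (X `&` Y)) ->
  (forall X g, C X -> C (translate X g)) ->
  (forall X, C X -> D (dset (uset q) X)) ->
  is_ultrafilter D p ->
  is_ultrafilter C [set X | C X /\ p (dset (uset q) X)].
Proof.
move=> CT CC CI Ct CD Up; have Uq := uset_ultra q.
split=> [X []//||||X Y|X CX].
- split=> //; rewrite (_ : dset _ _ = setT); first exact: ultra_setT Up.
  rewrite -subTset => g _ /=.
  by rewrite /dset /= translateE; apply: ultra_setT Uq.
- case=> _; rewrite (_ : dset _ _ = set0); first exact: ultra_set0 Up.
  rewrite -subset0 => g; rewrite /dset /= translateE.
  exact: ultra_set0 Uq.
- move=> X Y [CX pX] [CY pY]; split; first exact: CI.
  apply: (ultra_up Up (ultra_setI Up pX pY)); first exact/CD/CI.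
  move=> g [qX qY]; have := ultra_setI Uq qX qY.
  by rewrite /dset /= !translateE.
- move=> [CX pX] CY XY; split=> //.
  apply: (ultra_up Up pX); first exact: CD.
  move=> g qX; apply: (ultra_up Uq qX); first exact: Ct.
  by rewrite !translateE => x; exact: XY.
- have [pX|pX] := ultra_or Up (CD _ CX); [left|right]; split=> //.
    exact: CC.
  apply: (ultra_up Up pX); first exact/CD/CC.
  move=> g nq; have [//|] := ultra_or Uq (Ct _ g CX).
  by rewrite /dset /= !translateE.
Qed.

End translations.

Section shift.
Variables (L : language) (W : Type) (T : structure (oring_ext L) W).

Definition pair2 (A : Type) (u v : A) : 'I_2 -> A :=
  fun i => if i == ord0 then u else v.

Definition add_term n (u v : term (oring_ext L) n) : term (oring_ext L) n :=
  @App (oring_ext L) n (inl FAdd) (pair2 u v).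

Definition sadd (u v : W) : W :=
  @fint (oring_ext L) W T (inl FAdd) (pair2 u v).

Lemma eval_add_term n (u v : term (oring_ext L) n) x :
  eval T x (add_term u v) = sadd (eval T x u) (eval T x v).
Proof.
congr (@fint _ _ T (inl FAdd) _); apply/funext => i.
by rewrite /pair2; case: ifP.
Qed.

(** The formulas phi(x + y; a) and phi(y + x; a), in the variables x, with
    y and a as parameters. *)
Definition shiftf (b : bool) k (phi : formula (oring_ext L) (2 + k)) :
    formula (oring_ext L) (2 + (2 + k)) :=
  fsubst phi (fun i => match fintype.split i with
    | inl j => let u := Var (lshift _ j) in let v := Var (rshift _ (lshift _ j)) in
               if b then add_term u v else add_term v u
    | inr j => Var (rshift _ (rshift _ j)) end).

Lemma sat_shiftf b k (phi : formula (oring_ext L) (2 + k)) x y a :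
  sat T (shiftf b phi) (sapp x (sapp y a)) <->
  sat T phi (sapp (fun i => if b then sadd (x i) (y i) else sadd (y i) (x i)) a).
Proof.
rewrite sat_fsubst.
set f := (X in sat T phi X <-> _); set g := (X in _ <-> sat T phi X).
suff -> : f = g by [].
rewrite {}/f {}/g.
apply/funext => i; rewrite [RHS]/sapp; case: (fintype.split i) => j.
  by case: b; (etransitivity; first exact: eval_add_term);
    rewrite /= sapp_l sapp_r sapp_l.
by rewrite /= !sapp_r.
Qed.

End shift.

Section ellis.
Variables (R : rcfType) (L : language) (S : structure L R).
Local Notation M := (expansion S).
Variable N : saturated_extension M.
Local Notation G := ('I_2 -> R).

(** The algebras A and B of M-definable, respectively externally definable,
    subsets of M^2. *)
Definition defin : set (set G) := definable M setT (n := 2).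

Definition ext_defin : set (set G) :=
  [set X | exists2 Y : set ('I_2 -> N), definable (ext_str N) setT Y &
                                        X = [set x | Y (emb N \o x)]].

Lemma saddM (x y : R) : sadd M x y = x + y.
Proof. by []. Qed.

Lemma emb_add (x y : R) : emb N (x + y) = sadd (ext_str N) (emb N x) (emb N y).
Proof.
pose t (i : 'I_3) : term (oring_ext L) 3 := Var i.
pose phi := Equal (t ord0) (add_term (t (inord 1)) (t (inord 2))).
pose v (i : 'I_3) : R := nth 0 [:: x + y; x; y] i.
have /(emb_elementary N) : sat M phi v.
  by rewrite /phi [sat _ _ _]/sat eval_add_term saddM /v /= !inordK.
by rewrite /phi [sat _ _ _]/sat eval_add_term /v /= !inordK.
Qed.

Lemma emb_addf b (x y : G) :
  (fun i => if b then sadd (ext_str N) (emb N (x i)) (emb N (y i))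
            else sadd (ext_str N) (emb N (y i)) (emb N (x i))) =
  emb N \o (x + y).
Proof.
by apply/funext => i; case: b; rewrite -emb_add //= [y i + _]addrC.
Qed.

Lemma comp_sapp (A B : Type) (f : A -> B) n m (x : 'I_n -> A) (a : 'I_m -> A) :
  f \o sapp x a = sapp (f \o x) (f \o a).
Proof. by apply/funext => i; rewrite /= /sapp; case: (fintype.split i). Qed.

Lemma defin_setT : defin setT.
Proof.
pose phi : pformula (oring_ext L) R 2 :=
  @PFormula _ R 2 0 (@Equal _ 2 (Var ord0) (Var ord0)) (fun=> 0).
by exists phi => //; rewrite eqEsubset; split.
Qed.

Lemma definC X : defin X -> defin (~` X).
Proof. exact: definableC. Qed.

Lemma definI X Y : defin X -> defin Y -> defin (X `&` Y).
Proof. exact: definableI. Qed.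

Lemma defin_translate X g : defin X -> defin (translate X g).
Proof.
case=> -[k phi a] _ ->; exists (PFormula (2 + k) (shiftf true phi) (sapp g a)).
  by [].
rewrite translateE; rewrite eqEsubset.
by split=> x; rewrite /psat /= sat_shiftf /=.
Qed.

Lemma defin_ext X : defin X -> ext_defin X.
Proof.
case=> -[k phi a] _ ->.
exists [set x | psat (ext_str N) (PFormula k phi (emb N \o a)) x].
  by exists (PFormula k phi (emb N \o a)).
by rewrite eqEsubset; split=> x; rewrite /psat /= (emb_elementary N) comp_sapp.
Qed.

Lemma ext_defin_setT : ext_defin setT.
Proof. exact/defin_ext/defin_setT. Qed.

Lemma ext_definC X : ext_defin X -> ext_defin (~` X).
Proof. by case=> Y dY ->; exists (~` Y) => //; exact: definableC. Qed.

Lemma ext_definI X Y : ext_defin X -> ext_defin Y -> ext_defin (X `&` Y).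
Proof.
case=> X' dX -> [Y' dY ->]; exists (X' `&` Y') => //; exact: definableI.
Qed.

Lemma ext_defin_translate X g : ext_defin X -> ext_defin (translate X g).
Proof.
case=> _ [[k phi a] _ ->] ->.
set psi := PFormula (2 + k) (shiftf true phi) (sapp (emb N \o g) a).
exists [set x | psat (ext_str N) psi x]; first by exists psi.
rewrite translateE eqEsubset; split=> x; rewrite /psat /= sat_shiftf /=;
  by rewrite (emb_addf true).
Qed.

Lemma card_par k (a : 'I_k -> N) :
  (range (emb N) `|` range a #<= [set: R])%card.
Proof.
pose f (r : R) : N :=
  match pselect (exists m : nat, r = m%:R) with
  | left h => let m := projT1 (cid h) in
      if insub m : option 'I_k is Some i then a i else emb N (m - k)%:R
  | right _ => emb N r
  end.
have fnat m : f m%:R = if insub m : option 'I_k is Some i then a i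
                       else emb N (m - k)%:R.
  rewrite /f; case: pselect => [h|[]]; last by exists m.
  case: (cid h) => /= m' /eqP; rewrite eqr_nat => /eqP <- //.
apply: (@card_le_trans _ _ _ (range f)); last exact: card_image_le.
apply: subset_card_le => _ [[r _ <-]|[i _ <-]].
  have [[m ->]|h] := pselect (exists m : nat, r = m%:R).
    exists (m + k)%:R => //; rewrite fnat insubF ?addnK //.
    by rewrite ltnNge leq_addl.
  by exists r => //; rewrite /f; case: pselect.
exists (i : nat)%:R => //; rewrite fnat insubT // => lt_ik.
by congr (a _); exact: val_inj.
Qed.

Lemma ext_defin_dset (C : set (set G)) (q : ultra C) X :
  (forall Y, C Y -> C (~` Y)) ->
  (forall g, C (translate X g)) -> ext_defin X -> ext_defin (dset (uset q) X).
Proof.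
move=> CC Ct [_ [[k phi a] _ ->] XE]; have Uq := uset_ultra q.
have XP x : X x <-> sat (ext_str N) phi (sapp (emb N \o x) a) by rewrite XE.
pose gam b (g : G) : pformula (oring_ext L) N 2 :=
  PFormula (2 + k)
    (if b then shiftf true phi else Neg (shiftf true phi))
    (sapp (emb N \o g) a).
have gamP b g x : psat (ext_str N) (gam b g) x <->
    (if b then id else not)
      (sat (ext_str N) phi (sapp (fun i => sadd (ext_str N) (x i) (emb N (g i))) a)).
  by case: b; rewrite /psat /= sat_shiftf.
have [|||c cP] := @ext_saturated _ _ _ N (range (emb N) `|` range a) 2%N
    [set psi | exists g, psi = gam `[< uset q (translate X g) >] g].
- exact: card_par.
- move=> _ [g ->] i; rewrite /= /sapp; case: (fintype.split i) => j.
    by left; exists (g j).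
  by right; exists j.
- move=> l psi psiP.
  have /choice [g gP] := psiP.
  pose Z (i : 'I_l) := if `[< uset q (translate X (g i)) >] then translate X (g i)
                       else ~` translate X (g i).
  have qZ i : uset q (Z i).
    rewrite /Z; case: asboolP => // nq.
    by have [] := ultra_or Uq (Ct (g i)).
  have : uset q (\big[setI/setT]_(i < l) Z i).
    apply: (big_ind (uset q)) => //; first exact: ultra_setT Uq.
    exact: (@ultra_setI _ _ _ Uq).
  have [[x Zx] _|/forallNP Z0 qB] := pselect (exists x, forall i, Z i x).
    exists (emb N \o x) => i; rewrite gP; apply/gamP.
    have := Zx i; rewrite /Z /= (emb_addf true).
    by case: asboolP => _; rewrite translateE /= => /XP.
  exfalso; apply: (ultra_set0 Uq); move: qB.
  rewrite (_ : \big[_/_]_(_ < _) _ = set0) //.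
  rewrite -subset0 => x Zx.
  by apply: (Z0 x) => i; move: Zx; rewrite (bigD1 i) //= => -[].
have cE g : dset (uset q) X g <->
    sat (ext_str N) phi (sapp (fun i => sadd (ext_str N) (c i) (emb N (g i))) a).
  have /gamP := cP _ (ex_intro _ g erefl); rewrite /dset /=.
  by case: asboolP.
pose psi : pformula (oring_ext L) N 2 :=
  PFormula (2 + k) (shiftf false phi) (sapp c a).
exists [set x | psat (ext_str N) psi x]; first by exists psi.
by rewrite eqEsubset; split=> g; rewrite cE /psat /= sat_shiftf.
Qed.

(** S_G(M) and S_G^ext(M), with p * q = {X | d_q X in p} on the latter. *)
Definition types_G := ultra defin.
Definition ext_types_G := ultra ext_defin.

HB.instance Definition _ := Topological.on types_G.
HB.instance Definition _ := Topological.on ext_types_G.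

Lemma dset_ext (q : types_G) X : defin X -> ext_defin (dset (uset q) X).
Proof.
move=> dX; apply: ext_defin_dset; first exact: definC.
  by move=> g; exact: defin_translate.
exact: defin_ext.
Qed.

Lemma ext_mul_subproof (p q : ext_types_G) :
  is_ultrafilter ext_defin
    [set X | ext_defin X /\ uset p (dset (uset q) X)].
Proof.
apply: ultra_dset (uset_ultra p).
- exact: ext_defin_setT.
- exact: ext_definC.
- exact: ext_definI.
- exact: ext_defin_translate.
- move=> X dX; apply: ext_defin_dset => //; first exact: ext_definC.
  by move=> g; exact: ext_defin_translate.
Qed.

Definition ext_mul (p q : ext_types_G) : ext_types_G :=
  Ultra (ext_mul_subproof p q).

Lemma ell_subproof (p : ext_types_G) (q : types_G) :
  is_ultrafilter defin [set X | defin X /\ uset p (dset (uset q) X)].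
Proof.
apply: ultra_dset (uset_ultra p).
- exact: defin_setT.
- exact: definC.
- exact: definI.
- exact: defin_translate.
- exact: dset_ext.
Qed.

Definition ell (p : ext_types_G) (q : types_G) : types_G :=
  Ultra (ell_subproof p q).

Lemma ell_transl_subproof (g : G) (q : types_G) :
  is_ultrafilter defin [set X | defin X /\ uset q (translate X g)].
Proof.
apply: (@ultra_dset _ _ setT q [set Z | Z g]) => //.
- exact: defin_setT.
- exact: definC.
- exact: definI.
- exact: defin_translate.
- by split=> // [X Y Xg _|X _]; [exact|exact: lem].
Qed.

Definition ell_transl (g : G) (q : types_G) : types_G :=
  Ultra (ell_transl_subproof g q).

(** E(S_G(M)), a subset of S_G(M)^S_G(M) with the product topology; as a type
    it carries the subspace topology. *)
Definition ellis_G : set {ptws types_G -> types_G} :=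
  closure (range ell_transl : set {ptws types_G -> types_G}).

Lemma ell_ellis_G (p : ext_types_G) : ellis_G (ell p).
Proof.
have Up := uset_ultra p.
pose F : set_system G := [set Z | exists2 X, uset p X & X `<=` Z].
have FF : ProperFilter F.
  split=> [[X pX]|].
    by rewrite subset0 => X0; apply: (ultra_set0 Up); rewrite -X0.
  split; first by exists setT => //; exact: ultra_setT Up.
  - move=> Z Z' [X pX XZ] [X' pX' XZ']; exists (X `&` X').
      exact: (ultra_setI Up).
    by move=> x [/XZ ? /XZ' ?].
  - by move=> Z Z' ZZ' [X pX XZ]; exists X => //; exact: subset_trans ZZ'.
have cv : (ell_transl : G -> {ptws types_G -> types_G}) @ F -->
    (ell p : {ptws types_G -> types_G}).
  apply: ptws_cvg => q; apply: ultra_cvg => X [dX pX].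
  by exists (dset (uset q) X) => // g qX.
move=> B /cv [X pX XB].
have [g Xg] : X !=set0.
  apply/set0P/eqP => X0; apply: (ultra_set0 Up); rewrite -X0 //.
by exists (ell_transl g); split; [exists g|exact: XB].
Qed.

Lemma ell_transl_comp (g h : G) :
  ell_transl g \o ell_transl h = ell_transl (h + g).
Proof.
apply/funext => q; apply: ultra_inj => /=; rewrite eqEsubset.
split=> X /= [dX]; rewrite translate_translate; first by case.
by move=> qX; split=> //; split=> //; exact: defin_translate.
Qed.

Lemma ell_transl_continuous (g : G) : continuous (ell_transl g).
Proof.
move=> q; apply: ultra_cvg; first exact: (nbhs_filter q).
move=> X [dX qX]; have : nbhs q (ubase (translate X g)).
  by apply: nbhs_ubase => //; exact: defin_translate.
by apply: filterS => r rX; split.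
Qed.

Lemma ellis_mul_subproof (f h : {ptws types_G -> types_G}) :
  ellis_G f -> ellis_G h -> ellis_G (f \o h).
Proof.
have step (phi : {ptws types_G -> types_G} -> {ptws types_G -> types_G}) :
    continuous phi ->
    (forall g, ellis_G (phi (ell_transl g))) -> ellis_G `<=` phi @^-1` ellis_G.
  move=> cphi phiE; rewrite {1}/ellis_G closureE; apply: smallest_sub.
    apply: (@preimage_closed _ _ phi); first by move=> x _; exact: cphi.
    exact: closed_closure.
  by move=> _ [g _ <-]; exact: phiE.
move=> Ef Eh; apply: (step (fun f => f \o h)) => //.
  move=> k; apply: ptws_cvg => [|q]; first exact: (nbhs_filter k).
  exact: (@ptws_eval_continuous _ _ (h q) k).
move=> g; apply: (step (fun k => ell_transl g \o k)) => //.
  move=> k; apply: ptws_cvg => [|q]; first exact: (nbhs_filter k).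
  apply: (@continuous_comp _ _ _ (fun k : {ptws types_G -> types_G} => k q)
                           (ell_transl g) k); first exact: ptws_eval_continuous.
  exact: ell_transl_continuous.
by move=> g'; rewrite ell_transl_comp; apply: subset_closure; exists (g' + g).
Qed.

Definition ellis_mul (f h : ellis_G) : ellis_G :=
  exist _ (set_val f \o set_val h)
    (mem_set (ellis_mul_subproof (set_valP f) (set_valP h))).

Definition Lambda (p : ext_types_G) : ellis_G :=
  exist _ (ell p) (mem_set (@ell_ellis_G p)).

End ellis.

Definition ellis_isomorphism (A B : topologicalType) (mA : A -> A -> A)
    (mB : B -> B -> B) (f : A -> B) : Prop :=
  [/\ bijective f, continuous f & forall x y, f (mA x y) = mB (f x) (f y)].

Arguments ext_mul {R L S N}.
Arguments ellis_mul {R L S}.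
Arguments Lambda {R L S} N.

(* Main.v *)
Require Import Defs.
From mathcomp Require Import all_boot all_order all_algebra.
From mathcomp Require Import all_classical topology.
From mathcomp Require Import constructive_ereal lra zify.

(** Saturation gives a gap of M: an initial segment [G], namely the finite
    elements, without supremum in M.  The map [Lambda] is not injective: let p1
    and p2 contain the points (x, m x) with m close to the gap from the left,
    respectively from the right, and x large depending on m.  A slope c of N in
    the gap makes {(x, y) | y < c x} an externally definable set separating p1
    from p2.  But for M-definable X and a type q, realized by some (s, t) in N^2,
    the set d_q X = {(x, y) | (s + x, t + y) in X} is decided by the slopes
    around the gap.  Uniform finiteness reduces this to X = {(u, v) | v < f u}.
    If s is infinite over M, then for each m in M the sign of
    f (s + x) - f s - m x is the same for all x > 0 in M, because the x with a
    given sign form a definable semigroup; if s is bounded over M, the sign of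
    f u - m u is constant for large u.  In both cases the slope m at which the
    sign changes is a definable cut of M, hence is not at the gap. *)

Set Implicit Arguments.
Unset Strict Implicit.
Unset Printing Implicit Defensive.

Import Order.TTheory GRing.Theory Num.Theory.
Local Open Scope classical_set_scope.
Local Open Scope ring_scope.

(** * Definable sets and functions *)

Section definability.
Variables (R : rcfType) (L : language) (S : structure L R).
Local Notation M := (expansion S).

Definition Def (A : set R) n (P : ('I_n -> R) -> Prop) := definable M A P.

Definition tail n (z : 'I_n.+1 -> R) : 'I_n -> R := fun i => z (lift ord0 i).

Definition DefFun (A : set R) n (g : ('I_n -> R) -> R) :=
  Def A (fun z : 'I_n.+1 -> R => z ord0 = g (tail z)).

Definition Def1 A (P : R -> Prop) := Def A (fun z : 'I_1 -> R => P (z ord0)).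

Definition Def2 A (P : R -> R -> Prop) :=
  Def A (fun z : 'I_2 -> R => P (z ord0) (z ord_max)).

(** Argument first and value second, as in a binary relation; in [DefFun] the value comes first, at
    the index that [Ex] binds. *)
Definition DefFun1 A (f : R -> R) := Def2 A (fun u v => v = f u).

Variable A : set R.

Lemma Def_ext n (P Q : ('I_n -> R) -> Prop) :
  (forall x, P x <-> Q x) -> Def A P -> Def A Q.
Proof. by move=> PQ; rewrite (_ : P = Q) //; apply/funext => x; apply/propext. Qed.

Lemma Def_not n (P : ('I_n -> R) -> Prop) : Def A P -> Def A (fun x => ~ P x).
Proof. exact: definableC. Qed.

Lemma Def_and n (P Q : ('I_n -> R) -> Prop) :
  Def A P -> Def A Q -> Def A (fun x => P x /\ Q x).
Proof. exact: definableI. Qed.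

Lemma Def_or n (P Q : ('I_n -> R) -> Prop) :
  Def A P -> Def A Q -> Def A (fun x => P x \/ Q x).
Proof.
move=> dP dQ; apply: (@Def_ext _ (fun x => ~ (~ P x /\ ~ Q x))) => [x|].
  by rewrite not_andE !notK.
by apply/Def_not/Def_and; exact: Def_not.
Qed.

Lemma Def_imp n (P Q : ('I_n -> R) -> Prop) :
  Def A P -> Def A Q -> Def A (fun x => P x -> Q x).
Proof.
move=> dP dQ; apply: (@Def_ext _ (fun x => ~ P x \/ Q x)) => [x|].
  by rewrite implyE.
by apply: Def_or => //; exact: Def_not.
Qed.

(** [Ex] puts the bound variable before variables and parameters together, whereas a [pformula]
    counts it among the variables; the index types [(n + k).+1] and [n.+1 + k] are convertible. *)
Lemma scons_sapp (B : Type) n k (y : B) (x : 'I_n -> B) (a : 'I_k -> B) :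
  scons y (sapp x a) = sapp (n := n.+1) (scons y x) a.
Proof.
apply/funext => i; case: (split_ordP (m := n.+1) i) => j ->; last first.
  rewrite sapp_r (_ : (rshift n.+1 j : 'I_(n + k).+1) = lift ord0 (rshift n j));
    last exact: val_inj.
  by rewrite sconsS sapp_r.
rewrite sapp_l; case: (unliftP ord0 j) => [j' ->|->].
  rewrite (_ : (lshift k (lift ord0 j') : 'I_(n + k).+1) = lift ord0 (lshift k j'));
    last exact: val_inj.
  by rewrite !sconsS sapp_l.
rewrite (_ : (lshift k (ord0 : 'I_n.+1) : 'I_(n + k).+1) = ord0) ?scons0 //.
exact: val_inj.
Qed.

Lemma tail_scons n y (x : 'I_n -> R) : tail (scons y x) = x.
Proof. by apply/funext => i; rewrite /tail sconsS. Qed.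

Lemma Def_ex n (P : ('I_n -> R) -> R -> Prop) :
  Def A (fun z : 'I_n.+1 -> R => P (tail z) (z ord0)) ->
  Def A (fun x => exists y, P x y).
Proof.
case=> -[k phi a] oa E.
have {}E y x : P x y <-> sat M phi (scons y (sapp x a)).
  have := congr1 (fun F => F (scons y x)) E.
  by rewrite /= tail_scons scons0 scons_sapp => ->.
exists (@PFormula (oring_ext L) R n k (Ex phi) a) => //.
by rewrite eqEsubset; split=> x; rewrite /psat /= => -[y /E Py]; exists y.
Qed.

Lemma Def_all n (P : ('I_n -> R) -> R -> Prop) :
  Def A (fun z : 'I_n.+1 -> R => P (tail z) (z ord0)) ->
  Def A (fun x => forall y, P x y).
Proof.
move=> dP; apply: (@Def_ext _ (fun x => ~ exists y, ~ P x y)) => [x|].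
  by rewrite -forallNE; split=> h y; have := h y; rewrite notK.
by apply/Def_not/Def_ex/Def_not.
Qed.

(** As [s] is arbitrary, this covers weakening, permutation and identification of variables. *)
Lemma Def_rename n m (P : ('I_m -> R) -> Prop) (s : 'I_m -> 'I_n) :
  Def A P -> Def A (fun x : 'I_n -> R => P (x \o s)).
Proof.
case=> -[k phi a] oa ->.
pose t (i : 'I_(m + k)) : term (oring_ext L) (n + k) :=
  match fintype.split i with inl j => Var (lshift _ (s j))
                           | inr j => Var (rshift _ j) end.
exists (PFormula k (fsubst phi t) a) => //.
have E x : (fun i => Defs.eval M (sapp x a) (t i)) = sapp (x \o s) a.
  apply/funext => i; rewrite /t [RHS]/sapp; case: (fintype.split i) => j /=.
    exact: sapp_l.
  exact: sapp_r.
by rewrite eqEsubset; split=> x; rewrite /psat /= sat_fsubst E.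
Qed.

Lemma Def_eqproj n (i j : 'I_n) : Def A (fun x : 'I_n -> R => x i = x j).
Proof.
pose v (i : 'I_n) : term (oring_ext L) (n + 0) := Var (lshift 0 i).
exists (@PFormula (oring_ext L) R n 0 (Equal (v i) (v j)) (fun=> 0)) => [[]//|].
by rewrite eqEsubset; split=> x; rewrite /psat /= !sapp_l.
Qed.

Lemma Def_ltproj n (i j : 'I_n) : Def A (fun x : 'I_n -> R => x i < x j).
Proof.
pose v : 'I_2 -> term (oring_ext L) (n + 0) :=
  pair2 (Var (lshift 0 i)) (Var (lshift 0 j)).
exists (@PFormula (oring_ext L) R n 0 (@Atom (oring_ext L) _ (inl RLt) v)
  (fun=> 0)) => [[]//|].
by rewrite eqEsubset; split=> x; rewrite /psat /= !sapp_l.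
Qed.

Lemma DefFun_proj n (i : 'I_n) : DefFun A (fun x => x i).
Proof. exact: Def_eqproj. Qed.

Lemma DefFun_tail n (g : ('I_n -> R) -> R) :
  DefFun A g -> DefFun A (fun z : 'I_n.+1 -> R => g (tail z)).
Proof.
(* The renaming keeps the value at index 0 and skips index 1, the variable that [tail] discards. *)
pose s (i : 'I_n.+1) : 'I_n.+2 :=
  if unlift ord0 i is Some j then lift ord0 (lift ord0 j) else ord0.
move=> /(Def_rename s); apply: Def_ext => z; rewrite /= /s unlift_none.
suff -> : tail (z \o s) = tail (tail z) by [].
by apply/funext => i; rewrite /tail /= /s liftK.
Qed.

(** Functions are known through their graphs only, so composition quantifies over the intermediate
    value [y]. *)
Lemma DefFun_app1 n (f : R -> R) (g : ('I_n -> R) -> R) :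
  DefFun1 A f -> DefFun A g -> DefFun A (fun x => f (g x)).
Proof.
move=> df dg; apply: (@Def_ext _ (fun z : 'I_n.+1 -> R =>
    exists y, y = g (tail z) /\ z ord0 = f y)) => [z|].
  by split=> [[y [-> //]]|->]; exists (g (tail z)).
apply: (@Def_ex _ (fun z y => y = g (tail z) /\ z ord0 = f y)); apply: Def_and.
  exact: DefFun_tail.
exact: (Def_rename (pair2 (ord0 : 'I_n.+2) (lift ord0 ord0)) df).
Qed.

Lemma Def_app1 n (P : R -> Prop) (g : ('I_n -> R) -> R) :
  Def1 A P -> DefFun A g -> Def A (fun x => P (g x)).
Proof.
move=> dP dg; apply: (@Def_ext _ (fun z => exists y, y = g z /\ P y)) => [z|].
  by split=> [[y [-> //]]|?]; exists (g z).
apply: (@Def_ex _ (fun z y => y = g z /\ P y)); apply: Def_and => //.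
exact: (Def_rename (fun _ : 'I_1 => ord0) dP).
Qed.

Lemma Def_app2 n (P : R -> R -> Prop) (g h : ('I_n -> R) -> R) :
  Def2 A P -> DefFun A g -> DefFun A h -> Def A (fun x => P (g x) (h x)).
Proof.
move=> dP dg dh; apply: (@Def_ext _ (fun z => exists y, y = g z /\ P y (h z))) => [z|].
  by split=> [[y [-> //]]|?]; exists (g z).
apply: (@Def_ex _ (fun z y => y = g z /\ P y (h z))); apply: Def_and => //.
apply: (@Def_ext _ (fun z : 'I_n.+1 -> R =>
    exists y, y = h (tail z) /\ P (z ord0) y)) => [z|].
  by split=> [[y [-> //]]|?]; exists (h (tail z)).
apply: (@Def_ex _ (fun z y => y = h (tail z) /\ P (z ord0) y)); apply: Def_and.
  exact: (DefFun_tail dh).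
exact: (Def_rename (pair2 (lift ord0 ord0 : 'I_n.+2) ord0) dP).
Qed.

Lemma Def_lt n (g h : ('I_n -> R) -> R) :
  DefFun A g -> DefFun A h -> Def A (fun x => g x < h x).
Proof. by apply: (@Def_app2 _ (fun u v => u < v)); exact: Def_ltproj. Qed.

Lemma Def_eq n (g h : ('I_n -> R) -> R) :
  DefFun A g -> DefFun A h -> Def A (fun x => g x = h x).
Proof. by apply: (@Def_app2 _ (fun u v => u = v)); exact: Def_eqproj. Qed.

Lemma Def_le n (g h : ('I_n -> R) -> R) :
  DefFun A g -> DefFun A h -> Def A (fun x => g x <= h x).
Proof.
move=> dg dh; apply: (@Def_ext _ (fun x => ~ (h x < g x))) => [x|].
  by rewrite leNgt; split=> /negP.
exact/Def_not/Def_lt.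
Qed.

Lemma DefFun_param n c : A c -> DefFun A (fun _ : 'I_n -> R => c).
Proof.
move=> Ac; pose v : term (oring_ext L) (n.+1 + 1) := Var (lshift 1 ord0).
exists (@PFormula (oring_ext L) R n.+1 1 (Equal v (Var (rshift n.+1 ord0)))
  (fun=> c)) => //.
by rewrite eqEsubset; split=> x; rewrite /psat /= sapp_l sapp_r.
Qed.

Lemma DefFun_app2 n (f : R -> R -> R) (g h : ('I_n -> R) -> R) :
  Def A (fun z : 'I_3 -> R =>
    z ord0 = f (z (lift ord0 ord0)) (z (lift ord0 (lift ord0 ord0)))) ->
  DefFun A g -> DefFun A h -> DefFun A (fun x => f (g x) (h x)).
Proof.
move=> df dg dh; apply: (@Def_ext _ (fun z : 'I_n.+1 -> R =>
    exists y, y = g (tail z) /\ exists w, w = h (tail z) /\ z ord0 = f y w)) => [z|].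
  split=> [[y [-> [w [-> //]]]]|->].
  by exists (g (tail z)); split=> //; exists (h (tail z)).
apply: (@Def_ex _ (fun z y =>
  y = g (tail z) /\ exists w, w = h (tail z) /\ z ord0 = f y w)).
apply: Def_and; first exact: (DefFun_tail dg).
apply: (@Def_ex _ (fun z w => w = h (tail (tail z)) /\ tail z ord0 = f (z ord0) w)).
apply: Def_and; first exact: (DefFun_tail (DefFun_tail dh)).
(* After two quantifiers the order is [w], [y], value of the composite; [s] reverses it. *)
pose s (i : 'I_3) : 'I_n.+3 := match val i with
  | 0 => lift ord0 (lift ord0 ord0) | 1 => lift ord0 ord0 | _ => ord0 end.
exact: (Def_rename s df).
Qed.

Lemma DefFun_add n (g h : ('I_n -> R) -> R) :
  DefFun A g -> DefFun A h -> DefFun A (fun x => g x + h x).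
Proof.
apply: (@DefFun_app2 _ +%R).
pose v (i : 'I_3) : term (oring_ext L) (3 + 0) := Var (lshift 0 i).
exists (@PFormula (oring_ext L) R 3 0 (Equal (v ord0)
  (@App (oring_ext L) _ (inl FAdd)
    (pair2 (v (lift ord0 ord0)) (v (lift ord0 (lift ord0 ord0)))))) (fun=> 0)) => [[]//|].
by rewrite eqEsubset; split=> x; rewrite /psat /= !sapp_l.
Qed.

Lemma DefFun_mul n (g h : ('I_n -> R) -> R) :
  DefFun A g -> DefFun A h -> DefFun A (fun x => g x * h x).
Proof.
apply: (@DefFun_app2 _ *%R).
pose v (i : 'I_3) : term (oring_ext L) (3 + 0) := Var (lshift 0 i).
exists (@PFormula (oring_ext L) R 3 0 (Equal (v ord0)
  (@App (oring_ext L) _ (inl FMul)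
    (pair2 (v (lift ord0 ord0)) (v (lift ord0 (lift ord0 ord0)))))) (fun=> 0)) => [[]//|].
by rewrite eqEsubset; split=> x; rewrite /psat /= !sapp_l.
Qed.

Lemma DefFun_opp n (g : ('I_n -> R) -> R) :
  DefFun A g -> DefFun A (fun x => - g x).
Proof.
apply: (@DefFun_app1 _ -%R).
pose v (i : 'I_2) : term (oring_ext L) (2 + 0) := Var (lshift 0 i).
exists (@PFormula (oring_ext L) R 2 0 (Equal (v ord_max)
  (@App (oring_ext L) _ (inl FOpp) (fun=> v ord0))) (fun=> 0)) => [[]//|].
by rewrite eqEsubset; split=> x; rewrite /psat /= !sapp_l.
Qed.

Lemma DefFun_const n (c : oring_fun) (v : R) :
  oring_farity c = 0%N -> (forall x, oring_fint (f := c) x = v) ->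
  DefFun A (fun _ : 'I_n -> R => v).
Proof.
move=> c0 cv; pose t : term (oring_ext L) (n.+1 + 0) := Var (lshift 0 ord0).
exists (@PFormula (oring_ext L) R n.+1 0
  (Equal t (@App (oring_ext L) _ (inl c) (fun=> t))) (fun=> 0)) => [[]//|].
by rewrite eqEsubset; split=> x; rewrite /psat /= sapp_l cv.
Qed.

(** Numerals are built from the constants of the language, so they are available even over [set0],
    as in [below_nat_gap]. *)
Lemma DefFun_nat n (k : nat) : DefFun A (fun _ : 'I_n -> R => k%:R).
Proof.
elim: k => [|k IH]; first exact: (@DefFun_const _ FZero).
rewrite -addn1 natrD; apply: DefFun_add => //; exact: (@DefFun_const _ FOne).
Qed.

End definability.

(** * Automation of definability proofs *)

Ltac prove_DefFun :=
  first
  [ assumption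
  | exact: DefFun_proj
  | exact: DefFun_param
  | exact: (DefFun_nat _ _ _ 0)
  | exact: (DefFun_nat _ _ _ 1)
  | exact: DefFun_nat
  | apply: DefFun_add; prove_DefFun
  | apply: DefFun_opp; prove_DefFun
  | apply: DefFun_mul; prove_DefFun
  | match goal with H : DefFun1 _ _ _ |- _ => apply: (DefFun_app1 H); prove_DefFun end ].

(** An implication also matches the pattern [forall y, _]; therefore [Def_imp] is tried before
    [Def_all]. *)
Ltac prove_Def :=
  lazymatch goal with
  | |- Def _ _ (fun x => exists y, _) => refine (Def_ex _); prove_Def
  | |- Def _ _ (fun x => _ /\ _) => refine (Def_and _ _); prove_Def
  | |- Def _ _ (fun x => _ \/ _) => refine (Def_or _ _); prove_Def
  | |- Def _ _ (fun x => ~ _) => refine (Def_not _); prove_Def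
  | |- Def _ _ (fun x => forall y, _) =>
    first [refine (Def_imp _ _) | refine (Def_all _)]; prove_Def
  | |- Def _ _ (fun x => _ = _) => refine (Def_eq _ _); prove_DefFun
  | |- Def _ _ (fun x => is_true (_ < _)) => refine (Def_lt _ _); prove_DefFun
  | |- Def _ _ (fun x => is_true (_ <= _)) => refine (Def_le _ _); prove_DefFun
  | |- Def1 _ _ _ => rewrite /Def1; prove_Def
  | |- Def2 _ _ _ => rewrite /Def2; prove_Def
  | _ =>
    match goal with
    | H : Def1 _ _ ?P |- Def _ _ (fun x => ?P _) => apply: (Def_app1 H); prove_DefFun
    | H : Def2 _ _ ?P |- Def _ _ (fun x => ?P _ _) => apply: (Def_app2 H); prove_DefFun
    end
  end.

(** * One-variable consequences of o-minimality *)

Section ominimality.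
Variables (R : rcfType) (L : language) (S : structure L R).

Lemma pair2_eta (T : Type) (x : 'I_2 -> T) : x = pair2 (x ord0) (x ord_max).
Proof.
apply/funext => i; rewrite /pair2; case: eqP => [->//|].
by case: i => -[|[|//]] //= ? ne; [case: ne|congr x]; exact: val_inj.
Qed.

Lemma Def2_pair2 A (X : ('I_2 -> R) -> Prop) :
  Def S A X -> Def2 S A (fun u v => X (pair2 u v)).
Proof. by move=> dX; refine (Def_ext _ dX) => x; rewrite -pair2_eta. Qed.

Definition tame (E : seq R) (P : R -> Prop) : Prop :=
  forall x y, x <= y -> (forall e, e \in E -> ~ (x <= e <= y)) -> P x <-> P y.

Definition lower (P : R -> Prop) : Prop := forall x y, x <= y -> P y -> P x.

Hypothesis omin : o_minimal (expansion S).

(** [E] collects the isolated points and the endpoints of the intervals. [fine] sends an infinite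
    endpoint to 0, which is harmless: enlarging [E] weakens [tame]. *)
Lemma Def1_tame P : Def1 S setT P -> exists E, tame E P.
Proof.
case/omin => Q [J PE].
have {}PE x : P x <-> x \in Q \/ exists2 I, I \in J & (I.1 < x%:E < I.2)%E.
  exact: (iffLR (propeqP _ _) (congr1 (fun F => F (fun=> x)) PE)).
exists (Q ++ [seq fine p.1 | p <- J] ++ [seq fine p.2 | p <- J]) => x y xy nE.
have {}nE e : x <= e <= y -> [/\ e \notin Q, e \notin [seq fine p.1 | p <- J] &
                               e \notin [seq fine p.2 | p <- J]].
  move=> xey; apply/and3P; rewrite -!negb_or -!mem_cat.
  by apply/negP => /nE.
rewrite !PE; split=> -[Qx|[I IJ /andP[I1 I2]]].
- by have [] := nE x; rewrite ?lexx ?xy ?Qx.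
- right; exists I => //; rewrite (lt_le_trans I1) ?lee_fin //=.
  case E2 : I.2 I2 => [r| |] //=; rewrite ?ltry // !lte_fin => xr.
  rewrite ltNge; apply/negP => ry.
  have [|_ _ /negP[]] := nE r; first by rewrite (ltW xr).
  by apply/mapP; exists I; rewrite ?E2.
- by have [] := nE y; rewrite ?lexx ?xy ?Qx.
- right; exists I => //; rewrite (le_lt_trans _ I2) ?lee_fin // andbT.
  case E1 : I.1 I1 => [r| |] //=; rewrite ?ltNyr // !lte_fin => ry.
  rewrite ltNge; apply/negP => xr.
  have [|_ /negP[]] := nE r; first by rewrite (ltW ry) andbT.
  by apply/mapP; exists I; rewrite ?E1.
Qed.

Lemma seq_ub (E : seq R) : exists B, forall e, e \in E -> e < B.
Proof.
elim: E => [|e E [B EB]]; first by exists 0.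
exists (Num.max B (e + 1)) => e'; rewrite inE => /orP[/eqP ->|/EB e'B].
  by rewrite lt_max ltrDl ltr01 orbT.
by rewrite lt_max e'B.
Qed.

Lemma seq_lb (E : seq R) : exists B, forall e, e \in E -> B < e.
Proof.
have [B EB] := seq_ub [seq - e | e <- E]; exists (- B) => e Ee.
by rewrite ltrNl EB //; apply/mapP; exists e.
Qed.

Lemma seq_gap (E : seq R) : exists2 d, 0 < d & forall e, e \in E -> ~ (0 < e <= d).
Proof.
elim: E => [|e E [d d0 dE]]; first by exists 1.
have [e0|e0] := ltP 0 e; last first.
  exists d => // e'; rewrite inE => /orP[/eqP -> /andP[]|]; last exact: dE.
  by rewrite ltNge e0.
(* Half of [e], because [e] itself must stay outside the half-open interval up to the new bound. *)
exists (Num.min d (e / 2)) => [|e']; first by rewrite lt_min d0 /=; lra.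
rewrite inE le_min => /orP[/eqP -> /and3P[_ _]|]; first lra.
by move=> /dE h /and3P[? ? _]; apply: h; apply/andP.
Qed.

Variable P : R -> Prop.
Hypothesis dP : Def1 S setT P.

Lemma eventually_pinfty :
  exists B, (forall x, B < x -> P x) \/ (forall x, B < x -> ~ P x).
Proof.
have [E tE] := Def1_tame dP; have [B EB] := seq_ub E; exists B.
have PE x : B < x -> P x <-> P (B + 1).
  move=> Bx; have nE u v : B < u -> u <= v -> P u <-> P v.
    move=> Bu uv; apply: tE => // e /EB eB /andP[ue _]; lra.
  have [xB|Bx1] := leP x (B + 1); first exact: nE.
  symmetry; apply: nE; lra.
have [PB|PB] := lem (P (B + 1)); [left|right] => x /PE; tauto.
Qed.

Lemma eventually_ninfty :
  exists B, (forall x, x < B -> P x) \/ (forall x, x < B -> ~ P x).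
Proof.
have [E tE] := Def1_tame dP; have [B EB] := seq_lb E; exists B.
have PE x : x < B -> P x <-> P (B - 1).
  move=> Bx; have nE u v : v < B -> u <= v -> P u <-> P v.
    move=> Bu uv; apply: tE => // e /EB eB /andP[_ ue]; lra.
  have [xB|Bx1] := leP x (B - 1); first by apply: nE => //; lra.
  symmetry; apply: nE => //; lra.
have [PB|PB] := lem (P (B - 1)); [left|right] => x /PE; tauto.
Qed.

Lemma right_germ : exists2 d, 0 < d &
  (forall x, 0 < x -> x <= d -> P x) \/ (forall x, 0 < x -> x <= d -> ~ P x).
Proof.
have [E tE] := Def1_tame dP; have [d d0 dE] := seq_gap E; exists d => //.
have PE x : 0 < x -> x <= d -> P x <-> P d.
  by move=> x0 xd; apply: tE => // e /dE h /andP[xe ed]; apply: h; lra.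
have [Pd|Pd] := lem (P d); [left|right] => x x0 /PE; tauto.
Qed.

(** [R] need not be complete, so the cut is sought in the finite list [E]. Each point of [E] is the
    cut, or has a point outside [P] below it or a point of [P] above it; in the last two cases the
    interval from [a] to [b] shrinks so as to avoid it. An interval avoiding all of [E] contradicts
    tameness. *)
Lemma lower_cut a b : lower P -> P a -> ~ P b ->
  exists l, (forall x, x < l -> P x) /\ (forall x, l < x -> ~ P x).
Proof.
move=> lP; have [E tE] := Def1_tame dP.
suff: forall (E' : seq R) a b, P a -> ~ P b ->
    (exists l, (forall x, x < l -> P x) /\ (forall x, l < x -> ~ P x)) \/
    exists a' b', [/\ P a', ~ P b' & forall e, e \in E' -> ~ (a' <= e <= b')].
  move=> /(_ E a b) h Pa Pb; have [//|[a' [b' [Pa' Pb' nE]]]] := h Pa Pb.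
  have [ab|/ltW ba] := leP a' b'; last by exfalso; apply: Pb'; exact: lP Pa'.
  by have := tE _ _ ab nE; tauto.
elim=> [|e E' IH] {a b} a b Pa Pb; first by right; exists a, b.
have [h|[a1 [b1 [Pa1 Pb1 nE]]]] := IH _ _ Pa Pb; first by left.
have [[x [xe nPx]]|h1] := lem (exists x, x < e /\ ~ P x).
  right; exists a1, (Num.min b1 x); split=> //.
    by rewrite /Num.min; case: ifP.
  move=> e'; rewrite inE le_min.
  move=> /orP[/eqP -> /and3P[_ _]|/nE h /and3P[h1 h2 _]].
    lra.
  by apply: h; rewrite h1.
have [[x [xe nPx]]|h2] := lem (exists x, e < x /\ P x).
  right; exists (Num.max a1 x), b1; split=> //.
    by rewrite /Num.max; case: ifP.
  move=> e'; rewrite inE ge_max.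
  move=> /orP[/eqP -> /andP[/andP[_ ?] _]|/nE h /andP[/andP[h1' _] h2]].
    lra.
  by apply: h; rewrite h1'.
left; exists e; split=> x xe; last by move=> Px; apply: h2; exists x.
by apply: contrapT => Px; apply: h1; exists x.
Qed.

End ominimality.

(** * Uniform finiteness *)

Section fibres.
Variables (R : rcfType) (L : language) (S : structure L R).

(** [chain Y b j u v]: the fibre of Y over u contains j points, increasing from v
    on, that are alternately in Y and not in Y, beginning in Y iff [b]. *)
Fixpoint chain (Y : R -> R -> Prop) (b : bool) (j : nat) (u v : R) : Prop :=
  if j is i.+1 then
    exists w, v <= w /\ ((if b then Y u w else ~ Y u w) /\ chain Y (~~ b) i u w)
  else True.

Lemma Def2_chain A Y b j : Def2 S A Y -> Def2 S A (chain Y b j).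
Proof.
move=> dY; elim: j b => [|j IH] b.
  by refine (Def_ext (P := fun z => z ord0 = z ord0) _ _) => //; prove_Def.
by have dj := IH (~~ b); case: b dj => dj; rewrite /Def2 /=; prove_Def.
Qed.

Section chains.
Variable Y : R -> R -> Prop.

Lemma chain_lower b j u : lower (chain Y b j u).
Proof. by case: j => // j v v' vv' [w [v'w h]]; exists w; split=> //; lra. Qed.

Lemma chain_pred b j u v : chain Y b j.+1 u v -> chain Y b j u v.
Proof.
elim: j b v => // j IH b v [w [vw [Yw h]]].
by exists w; split=> //; split=> //; exact: IH.
Qed.

Lemma chain_leq b i j u v : (i <= j)%N -> chain Y b j u v -> chain Y b i u v.
Proof.
elim: j => [|j IH]; first by rewrite leqn0 => /eqP ->.
by rewrite leq_eqVlt ltnS => /orP[/eqP -> //|/IH h] /chain_pred.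
Qed.

Lemma chain_tail b j u v : chain Y b j.+1 u v -> chain Y (~~ b) j u v.
Proof. by move=> [w [vw [_]]]; exact: chain_lower. Qed.

Lemma count_lt (T : eqType) (p q : pred T) (s : seq T) x :
  (forall y, p y -> q y) -> x \in s -> q x -> ~~ p x ->
  (count p s < count q s)%N.
Proof.
move=> pq; elim: s => //= y s IH; rewrite inE => /orP[/eqP <- qx npx|xs qx npx].
  by rewrite qx (negbTE npx) add0n add1n ltnS sub_count.
have := IH xs qx npx; have := pq y; case: (p y); case: (q y) => //=; try lia.
Qed.

(* Two consecutive alternations use up a point of E for good. *)
Lemma tame_chain E u b j v : tame E (Y u) -> chain Y b j u v ->
  (j <= (count (fun e => (v <= e)%R) E).*2.+1)%N.
Proof.
move=> tE; elim/ltn_ind: j b v => -[|[|j]] // IH b v.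
move=> [w1 [vw1 [Y1 [w2 [w12 [Y2 h]]]]]]; rewrite negbK in h.
have [e [Ee /andP[w1e ew2]]] : exists e, e \in E /\ w1 <= e <= w2.
  apply: contrapT => nE; have : Y u w1 <-> Y u w2.
    by apply: tE => // e Ee we; apply: nE; exists e.
  by case: b Y1 Y2 {h} => /=; tauto.
(* [w3] must lie strictly beyond [w2], hence beyond [e]. At the end of the chain any such point will
   do; otherwise the next point differs from [w2] because the two disagree about [Y u]. *)
have [w3 [w23 h3]] : exists w3, w2 < w3 /\ chain Y b j u w3.
  case: j h {IH} => [|j] h; first by exists (w2 + 1); split=> //; lra.
  case: h => w3 [w23 [Y3 h]]; exists w3; split; last by exists w3; split.
  rewrite lt_neqAle w23 andbT; apply/eqP => w2E; move: Y2 Y3.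
  by rewrite -w2E; case: (b) => /=; tauto.
have := IH j _ b w3 h3; rewrite leqnSn => /(_ isT).
have : (count (fun e => w3 <= e)%R E < count (fun e => v <= e)%R E)%N.
  apply: (@count_lt _ _ _ _ e) => //; first by move=> y; lra.
    by lra.
  by rewrite -ltNge; lra.
lia.
Qed.

(* [Y u v] holds iff the longest chains from v on begin in Y, so Y is a Boolean
   combination of sets with lower fibres. *)
Lemma chainE K u v : (forall b, ~ chain Y b K u v) ->
  Y u v <-> exists j, (j < K)%N /\
                      (chain Y true j.+1 u v /\ ~ chain Y false j.+1 u v).
Proof.
move=> nK; split=> [Yuv|[j [_ [[w [vw [Yw h]]] nc]]]].
  apply: contrapT => h.
  (* If no [j] works, every chain beginning in [Y] comes with one of the same length beginning
     outside, and putting [v] in front of the latter gives a longer chain beginning in [Y]. *)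
  have {}h j : chain Y true j.+1 u v.
    elim: j => [|j IH]; first by exists v; split.
    exists v; split=> //; split=> //; apply: contrapT => nc; apply: h.
    exists j; split=> //; rewrite ltnNge; apply/negP => Kj.
    by apply: (nK true); apply: chain_leq IH; exact: leqW.
  exact: (nK true (chain_pred (h K))).
apply: contrapT => nY; apply: nc; apply: chain_pred.
exists v; split=> //; split=> //; exists w; split=> //.
Qed.

End chains.

Hypothesis omin : o_minimal (expansion S).
Hypothesis sat0 : aleph0_saturated (expansion S).

Lemma Def_finite_params n (P : ('I_n -> R) -> Prop) :
  Def S setT P -> exists2 A, finite_set A & Def S A P.
Proof.
case=> -[k phi a] _ ->; exists (range a).
  apply: finite_image; exact: finite_finset.
by exists (PFormula k phi a) => // i; exists i.
Qed.

(** In a decreasing sequence, finitely many conditions amount to the one of largest index, so the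
    partial type is finitely satisfiable. *)
Lemma decreasing_realized A n (P : nat -> ('I_n -> R) -> Prop) :
  finite_set A -> (forall k, Def S A (P k)) ->
  (forall i j x, (i <= j)%N -> P j x -> P i x) ->
  (forall k, exists x, P k x) -> exists x, forall k, P k x.
Proof.
move=> fA dP Pleq Pex.
have /choice[phi phiP] : forall k, exists phi : pformula (oring_ext L) R n,
    Defs.over A phi /\ forall x, psat (expansion S) phi x <-> P k x.
  move=> k; have [phi phiA E] := dP k; exists phi; split=> // x.
  by have := congr1 (fun F => F x) E => /= ->.
have phiA psi : range phi psi -> Defs.over A psi.
  by move=> [k _ <-]; have [] := phiP k.
have phi_fin l (psi : 'I_l -> pformula (oring_ext L) R n) :
    (forall i, range phi (psi i)) ->
    exists x, forall i, psat (expansion S) (psi i) x.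
  move=> psiP; have /choice[g gP] : forall i, exists k, phi k = psi i.
    by move=> i; have [k _ <-] := psiP i; exists k.
  have [x Px] := Pex (\max_i g i); exists x => i.
  by rewrite -gP; apply/(phiP _).2; apply: Pleq Px; exact: leq_bigmax.
have [x xP] := sat0 fA phiA phi_fin.
by exists x => k; apply/(phiP k).2/xP; exists k.
Qed.

(** Uniform finiteness: if chains of every length occurred, saturation would yield one point of one
    fibre from which chains of all lengths start, against [tame_chain]. *)
Lemma Def2_bounded_chains Y : Def2 S setT Y ->
  exists K, forall b u v, ~ chain Y b K u v.
Proof.
move=> dY; apply: contrapT => nK.
have {}nK K : exists z : 'I_2 -> R, chain Y true K (z ord0) (z ord_max).
  apply: contrapT => h; apply: nK; exists K.+1 => -[] u v c; apply: h;
    exists (pair2 u v); first exact: chain_pred.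
  exact: (chain_tail c).
have [A fA dA] := Def_finite_params dY.
have [i j x|x xP] := decreasing_realized fA (fun K => Def2_chain true K dA) _ nK.
  exact: chain_leq.
have [E tE] : exists E, tame E (Y (x ord0)) by apply: (Def1_tame omin); prove_Def.
by have := tame_chain tE (xP (count (fun e => x ord_max <= e) E).*2.+2); rewrite ltnn.
Qed.

(* If f were unbounded near all large points, the sets {|f| <= k} would have
   empty interior there but arbitrarily many points, against uniform finiteness. *)
Lemma locally_bounded f : DefFun1 S setT f ->
  exists B, forall a b, B < a -> exists k, forall u, a <= u -> u <= b ->
    - k <= f u /\ f u <= k.
Proof.
move=> df; pose bad u := forall e, 0 < e -> forall k, exists u',
  u - e < u' /\ (u' < u + e /\ ~ (- k <= f u' /\ f u' <= k)).
have dbad : Def1 S setT bad by rewrite /bad; prove_Def.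
have [B [Bbad|Bbad]] := eventually_pinfty omin dbad.
  pose Y k u := B < u /\ (- k <= f u /\ f u <= k).
  have dY : Def2 S setT Y by rewrite /Y; prove_Def.
  have [K nK] := Def2_bounded_chains dY.
  (* In the fibre over [k], the chain uses [v], [v + 1] and so on, which belong to it once [k] is
     large, and between them points near the bad [v + 1 / 2], where [f] exceeds [k] in absolute
     value. *)
  have h j v : B < v -> exists k0, forall k, k0 <= k -> chain Y true j k v.
    elim/ltn_ind: j v => -[|[|j]] IH v Bv; first by exists 0.
      exists `|f v| => k; rewrite ler_norml => /andP[? ?]; exists v.
      by split=> //; split.
    have Bv1 : B < v + 1 by lra.
    have [k0 k0P] := IH j (leqnSn _) (v + 1) Bv1.
    exists (Num.max k0 `|f v|) => k; rewrite ge_max ler_norml => /and3P[k0k ? ?].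
    exists v; split=> //; split; first by split=> //; split; lra.
    have Bv2 : B < v + 1 / 2 by lra.
    have e0 : 0 < 1 / 2 :> R by lra.
    have [w [w1 [w2 nw]]] := Bbad _ Bv2 _ e0 k.
    exists w; split; first lra.
    split; first by move=> [].
    rewrite /=; apply: chain_lower (k0P _ k0k); lra.
  exfalso; have [|k0 k0P] := h K (B + 1); first lra.
  exact: nK (k0P k0 (lexx _)).
exists B => a b Ba.
pose P b := exists k, forall u, a <= u -> u <= b -> - k <= f u /\ f u <= k.
have dP : Def1 S setT P by rewrite /P; prove_Def.
have lP : lower P.
  by move=> x y xy [k kP]; exists k => u au ux; apply: kP => //; lra.
have Pa : P a.
  exists `|f a| => u au ua; have -> : u = a by lra.
  by have := lexx `|f a|; rewrite {1}ler_norml => /andP[].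
change (P b); apply: contrapT => nPb.
have [l [lP1 lP2]] := lower_cut omin dP lP Pa nPb.
have al : a <= l by rewrite leNgt; apply/negP => /lP2.
(* Were [f] bounded near the cut [l], this bound and the one up to [l - e / 2] would together give a
   bound beyond [l]. *)
have [|] := Bbad l; first lra.
move=> e e0 k; apply: contrapT => nk.
have [|k' k'P] := lP1 (l - e / 2); first lra.
have [|] := lP2 (l + e / 2); first lra.
exists (Num.max k k') => u au ue.
have [k1 k2] : k <= Num.max k k' /\ k' <= Num.max k k' by rewrite !le_max !lexx orbT.
have [ul|lu] := leP u (l - e / 2); first by have := k'P _ au ul; lra.
have [|] := lem (- k <= f u /\ f u <= k); first lra.
by move=> nu; exfalso; apply: nk; exists u; do !split => //; lra.
Qed.

End fibres.

(** * Slopes near a gap *)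

(** In [gap_nocut] the side of [l] itself is left open, so [G] has no greatest element and its
    complement no least one. *)
Record is_gap (R : rcfType) (G : R -> Prop) : Prop := IsGap {
  gap_lower : lower G;
  gap_in : exists a, G a;
  gap_out : exists b, ~ G b;
  gap_nocut : forall l, ~ ((forall x, x < l -> G x) /\ (forall x, l < x -> ~ G x)) }.

Section decision.
Variables (R : rcfType) (L : language) (S : structure L R).
Hypothesis omin : o_minimal (expansion S).
Hypothesis sat0 : aleph0_saturated (expansion S).
Variables (G : R -> Prop) (gapG : is_gap G).

Lemma gap_lt a b : G a -> ~ G b -> a < b.
Proof. by move=> Ga Gb; rewrite ltNge; apply/negP => /(gap_lower gapG)/(_ Ga). Qed.

Lemma gap_succ a : G a -> exists2 m, a < m & G m.
Proof.
move=> Ga; apply: contrapT => h; apply: (gap_nocut gapG (l := a)); split=> x xa.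
  by apply: (gap_lower gapG) Ga; exact: ltW.
by move=> Gx; apply: h; exists x.
Qed.

Lemma gap_pred b : ~ G b -> exists2 m, m < b & ~ G m.
Proof.
move=> Gb; apply: contrapT => h; apply: (gap_nocut gapG (l := b)); split=> x xb.
  by apply: contrapT => nGx; apply: h; exists x.
by move=> Gx; apply: Gb; apply: (gap_lower gapG) Gx; exact: ltW.
Qed.

(** By [lower_cut] a definable [D] cannot be the complement of [G]. So [D] meets [G] or misses a
    point outside [G], and monotonicity makes it constant on an interval around the gap. *)
Lemma gap_upper D : Def1 S setT D -> (forall x y, x <= y -> D x -> D y) ->
  exists a b, G a /\ (~ G b /\
    ((forall m, a < m -> m < b -> D m) \/ (forall m, a < m -> m < b -> ~ D m))).
Proof.
move=> dD uD; have [a0 Ga0] := gap_in gapG; have [b0 Gb0] := gap_out gapG.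
apply: contrapT => nD.
have GD a : G a -> ~ D a.
  move=> Ga Da; apply: nD; exists a, b0; do 2!split=> //; left=> m am _.
  by apply: uD Da; exact: ltW.
have nGD b : ~ G b -> D b.
  move=> Gb; apply: contrapT => Db; apply: nD; exists a0, b; do 2!split=> //.
  by right=> m _ mb Dm; apply: Db; apply: uD Dm; exact: ltW.
have dnD : Def1 S setT (fun m => ~ D m) by prove_Def.
have lnD : lower (fun m => ~ D m) by move=> x y xy Dy /(uD _ _ xy).
have [|l [l1 l2]] := lower_cut omin dnD lnD (GD _ Ga0) (b := b0).
  by rewrite notK; exact: nGD.
apply: (gap_nocut gapG (l := l)); split=> x xl.
  by apply: contrapT => /nGD; exact: l1.
by move=> /GD; exact: l2.
Qed.

(** The bound [h] may depend on [m], matching the two external types: they contain [(x, m x)] for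
    slopes [m] near the gap and [x] large depending on [m], so they cannot disagree on a decided
    externally definable set. *)
Definition decided (W : R -> R -> Prop) : Prop := exists a b, G a /\ (~ G b /\
  ((forall m, a < m -> m < b -> exists h, forall x, h < x -> W x (m * x)) \/
   (forall m, a < m -> m < b -> exists h, forall x, h < x -> ~ W x (m * x)))).

Lemma decidedT W h : (forall x y, h < x -> W x y) -> decided W.
Proof.
move=> hW; have [a Ga] := gap_in gapG; have [b Gb] := gap_out gapG.
by exists a, b; do 2!split=> //; left=> m _ _; exists h => x hx; exact: hW.
Qed.

Lemma decidedF W h : (forall x y, h < x -> ~ W x y) -> decided W.
Proof.
move=> hW; have [a Ga] := gap_in gapG; have [b Gb] := gap_out gapG.
by exists a, b; do 2!split=> //; right=> m _ _; exists h => x hx; exact: hW.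
Qed.

Lemma decided_not W : decided W -> decided (fun x y => ~ W x y).
Proof.
move=> [a [b [Ga [Gb [h|h]]]]]; exists a, b; do 2!split=> //; [right|left] => m am mb.
  by have [B hB] := h m am mb; exists B => x /hB Wx; exact.
exact: h.
Qed.

Lemma decided_and V W : decided V -> decided W -> decided (fun x y => V x y /\ W x y).
Proof.
move=> [a [b [Ga [Gb hV]]]] [a' [b' [Ga' [Gb' hW]]]].
case: hV => [hVT|hVF]; last first.
  exists a, b; do 2!split=> //; right=> m am mb.
  by have [h hB] := hVF m am mb; exists h => x /hB; tauto.
exists (Num.max a a'), (Num.min b b'); split; first by rewrite /Num.max; case: ifP.
split; first by rewrite /Num.min; case: ifP.
case: hW => hW; [left|right] => m; rewrite gt_max lt_min => /andP[am am'] /andP[mb mb'];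
  have [h hh] := hVT m am mb; have [h' hh'] := hW m am' mb';
  exists (Num.max h h') => x; rewrite gt_max => /andP[/hh ? /hh' ?]; tauto.
Qed.

(* If P holds on (0, l) then it holds on (0, 2 l), by halving. *)
Lemma semigroup_pos P : Def1 S setT P ->
  (forall x y, P x -> P y -> P (x + y)) ->
  (exists2 d, 0 < d & forall x, 0 < x -> x <= d -> P x) -> forall x, 0 < x -> P x.
Proof.
move=> dP PD [d d0 Pd] x x0; apply: contrapT => nPx.
pose D b := forall y, 0 < y -> y <= b -> P y.
have dD : Def1 S setT D by rewrite /D; prove_Def.
have lD : lower D by move=> y z yz Dz w w0 wy; apply: Dz => //; lra.
have nDx : ~ D x by move=> /(_ x x0 (lexx _)).
have [l [l1 l2]] := lower_cut omin dD lD Pd nDx.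
have dl : d <= l by rewrite leNgt; apply/negP => /l2; exact.
(* Points up to [3 / 2 * l] have halves up to [3 / 4 * l], which is still below the cut. *)
apply: (l2 (3 / 2 * l)); first lra.
move=> y y0 yl; have -> : y = y / 2 + y / 2 by lra.
have Dl : D (3 / 4 * l) by apply: l1; lra.
by apply: PD; apply: Dl; lra.
Qed.

(** By o-minimality one of [P] and its complement holds just to the right of 0, and [semigroup_pos]
    spreads it to all positive points. *)
Lemma semigroup_dichotomy P : Def1 S setT P ->
  (forall x y, P x -> P y -> P (x + y)) ->
  (forall x y, ~ P x -> ~ P y -> ~ P (x + y)) ->
  (forall x, 0 < x -> P x) \/ (forall x, 0 < x -> ~ P x).
Proof.
move=> dP PD nPD; have [d d0 [Pd|Pd]] := right_germ omin dP; [left|right].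
  by apply: semigroup_pos => //; exists d.
apply: semigroup_pos => //; last by exists d.
by prove_Def.
Qed.

(** * Types of pairs [(s, t)] over [M] *)

Section type.
Variable q : set (set ('I_2 -> R)).
Hypothesis Uq : is_ultrafilter (definable (expansion S) setT (n := 2)) q.

(** [qall P]: the realization (s, t) of the type q satisfies P. *)
Definition qall (P : R -> R -> Prop) : Prop := q [set z | P (z ord0) (z ord_max)].

Lemma qall_up P P' : qall P -> Def2 S setT P' -> (forall s t, P s t -> P' s t) ->
  qall P'.
Proof. by move=> qP dP' PP'; apply: (ultra_up Uq qP) => // z; exact: PP'. Qed.

Lemma qallI P P' : qall P -> qall P' -> qall (fun s t => P s t /\ P' s t).
Proof. exact: (ultra_setI Uq). Qed.

Lemma qall_up2 P1 P2 P' : qall P1 -> qall P2 -> Def2 S setT P' ->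
  (forall s t, P1 s t -> P2 s t -> P' s t) -> qall P'.
Proof.
by move=> q1 q2 dP' h; apply: (qall_up (qallI q1 q2)) => // s t []; exact: h.
Qed.

Lemma qall_ex P : qall P -> exists s t, P s t.
Proof.
move=> qP; apply: contrapT => nP; apply: (ultra_set0 Uq).
apply: (ultra_up Uq qP); first by have := definableC (defin_setT S); rewrite setCT.
by move=> z Pz; apply: nP; exists (z ord0), (z ord_max).
Qed.

Lemma qall_not P : Def2 S setT P -> qall (fun s t => ~ P s t) <-> ~ qall P.
Proof.
move=> dP; split=> [qnP qP|nqP]; last by have [|] := ultra_or Uq dP.
by have [s [t []]] := qall_ex (qallI qnP qP).
Qed.

Lemma qall_bounded (g : R -> R -> R) :
  DefFun S setT (fun z : 'I_2 -> R => g (z ord0) (z ord_max)) ->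
  (forall k, qall (fun s t => k < g s t)) \/
  ((forall k, qall (fun s t => g s t < k)) \/
   exists k1 k2, qall (fun s t => k1 <= g s t /\ g s t <= k2)).
Proof.
move=> dg; apply: contrapT; rewrite !not_orE -!existsNE.
move=> [[k2 /qall_not h2] [[k1 /qall_not h1] h]]; apply: h; exists k1, k2.
apply: (qall_up2 (h1 _) (h2 _)); [by prove_Def|by prove_Def|by prove_Def|].
by move=> s t /negP + /negP; rewrite -!leNgt.
Qed.

(** * Sets whose fibres are cut off by a definable function [f] *)

Section lower_fibres.
Variables (Y : R -> R -> Prop) (f : R -> R) (pr : R -> Prop).
Hypotheses (dY : Def2 S setT Y) (df : DefFun1 S setT f) (dpr : Def1 S setT pr).
Hypothesis Yf : forall u, pr u ->
  (forall v, v < f u -> Y u v) /\ (forall v, f u < v -> ~ Y u v).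

Local Notation W := (fun x y => qall (fun s t => Y (s + x) (t + y))).

Section at_x.
Variables (x y : R).
Hypothesis qpr : qall (fun s _ => pr (s + x)).

Lemma qallY_I : qall (fun s t => t + y < f (s + x)) -> W x y.
Proof.
move=> qf; apply: (qall_up2 qpr qf); first by prove_Def.
by move=> s t /Yf[h _]; exact: h.
Qed.

Lemma qallY_notI : qall (fun s t => f (s + x) < t + y) -> ~ W x y.
Proof.
move=> qf; apply/qall_not; first by prove_Def.
apply: (qall_up2 qpr qf); first by prove_Def.
by move=> s t /Yf[_ h]; exact: h.
Qed.

(** The inequality is weak because [Yf] is silent about the boundary [v = f u]. *)
Lemma qallY_E : W x y -> qall (fun s t => t + y <= f (s + x)).
Proof.
move=> qf; apply: (qall_up2 qpr qf); first by prove_Def.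
by move=> s t /Yf[_ h] Yst; rewrite leNgt; apply/negP => /h.
Qed.

Lemma qallY_notE : ~ W x y -> qall (fun s t => f (s + x) <= t + y).
Proof.
move=> /qall_not qf; apply: (qall_up2 qpr (qf _)); [by prove_Def|by prove_Def|].
by move=> s t /Yf[h _] Yst; rewrite leNgt; apply/negP => /h.
Qed.

End at_x.

(* The hypotheses on q say that s is infinite over M: its type over M is invariant
   under translation and definable. *)
Lemma decided_invariant :
  (forall P x, Def1 S setT P -> qall (fun s _ => P s) -> qall (fun s _ => P (s + x))) ->
  (forall P, Def2 S setT P -> Def1 S setT (fun x => qall (fun s _ => P x s))) ->
  qall (fun s _ => pr s) -> decided W.
Proof.
move=> shift defq qpr0.
have qpr x : qall (fun s _ => pr (s + x)) by exact: shift.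
(* For positive [x]: the chord of [f] from [s] to [s + x] has slope below [m]. Invariance lets a
   second chord start at [s + x], so [P m] and its complement are closed under addition. *)
pose P m x := qall (fun s _ => f (s + x) < f s + m * x).
have dlt m x : Def1 S setT (fun s => f (s + x) < f s + m * x) by prove_Def.
have nP m x : ~ P m x -> qall (fun s _ => f s + m * x <= f (s + x)).
  rewrite /P => /qall_not nP; apply: qall_up (nP _) _ _; [by prove_Def|by prove_Def|].
  by move=> s _ /negP; rewrite -leNgt.
have T m : (forall x, 0 < x -> P m x) \/ (forall x, 0 < x -> ~ P m x).
  apply: semigroup_dichotomy.
  - by apply: (defq (fun x s => f (s + x) < f s + m * x)); prove_Def.
  - move=> x y Px Py.
    have {}Py := shift (fun s => f (s + y) < f s + m * y) x (dlt m y) Py.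
    apply: (qall_up2 Px Py); first by prove_Def.
    by move=> s _; rewrite -addrA; lra.
  - move=> x y /nP Px /nP Py.
    have {}Py := shift (fun s => f s + m * y <= f (s + y)) x ltac:(prove_Def) Py.
    apply/qall_not; first by prove_Def.
    apply: (qall_up2 Px Py); first by prove_Def.
    by move=> s _; rewrite -addrA; lra.
(* Here [f] falls faster than every line over [M]: once [(x1, y1)] lies outside [W], so does
   everything to the right of it. *)
have [iP|iP] := lem (forall m x, 0 < x -> P m x).
  have [[x1 [y1 [x10 nW]]]|aW] := lem (exists x1 y1, 0 < x1 /\ ~ W x1 y1).
    apply: (@decidedF _ x1) => x y x1x; apply: qallY_notI => //.
    have xx0 : 0 < x - x1 by lra.
    have h := shift _ x1 (dlt _ _) (iP ((y - y1) / (x - x1)) (x - x1) xx0).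
    apply: (qall_up2 h (qallY_notE (qpr x1) nW)).
      by prove_Def.
    move=> s t; rewrite divfK; last by rewrite gt_eqF.
    have -> : s + x1 + (x - x1) = s + x by lra.
    lra.
  apply: (@decidedT _ 0) => x y x0; apply: contrapT => nW; apply: aW.
  by exists x, y.
have [iiP|iiP] := lem (forall m x, 0 < x -> ~ P m x).
  have [[x1 [y1 [x10 yW]]]|aW] := lem (exists x1 y1, 0 < x1 /\ W x1 y1).
    apply: (@decidedT _ x1) => x y x1x; apply: qallY_I => //.
    have xx0 : 0 < x - x1 by lra.
    (* The summand 1 turns the weak inequalities from [nP] and [qallY_E] into the strict one that
       [qallY_I] asks for. *)
    pose m := (y - y1 + 1) / (x - x1).
    have h := shift (fun s => f s + m * (x - x1) <= f (s + (x - x1))) x1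
      ltac:(prove_Def) (nP _ _ (iiP m (x - x1) xx0)).
    rewrite /m in h; apply: (qall_up2 h (qallY_E (qpr x1) yW)).
      by prove_Def.
    move=> s t; rewrite divfK; last by rewrite gt_eqF.
    have -> : s + x1 + (x - x1) = s + x by lra.
    lra.
  apply: (@decidedF _ 0) => x y x0 yW; apply: aW.
  by exists x, y.
have [m0 m0P] : exists m0, forall x, 0 < x -> ~ P m0 x.
  apply: contrapT => h; apply: iP => m; have [//|nPm] := T m.
  by exfalso; apply: h; exists m.
have [m1 m1P] : exists m1, forall x, 0 < x -> P m1 x.
  apply: contrapT => h; apply: iiP => m; have [Pm|//] := T m.
  by exfalso; apply: h; exists m.
have dr : DefFun S setT (fun z : 'I_2 -> R => z ord_max - f (z ord0)) by prove_DefFun.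
(* All chord slopes now lie between [m0] and [m1], so an infinite [t - f s] outweighs them and
   settles every [x > 0]. *)
have [rP|[rN|[k2 [k1 rb]]]] := qall_bounded (g := fun s t => t - f s) dr.
- apply: (@decidedF _ 0) => x y x0; apply: qallY_notI => //.
  apply: (qall_up2 (rP (m1 * x - y)) (m1P x x0)); first by prove_Def.
  by move=> s t; lra.
- apply: (@decidedT _ 0) => x y x0; apply: qallY_I => //.
  apply: (qall_up2 (rN (m0 * x - y)) (nP _ _ (m0P x x0))); first by prove_Def.
  by move=> s t; lra.
(* By [T], the value at [x = 1] stands for all positive [x]. *)
have [||a [b [Ga [Gb ab]]]] := @gap_upper (fun m => P m 1).
- by apply: (defq (fun m s => f (s + 1) < f s + m * 1)); prove_Def.
- move=> m m' mm' Pm; apply: (qall_up Pm); first by prove_Def.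
  by move=> s _; lra.
have ltab := gap_lt Ga Gb.
exists a, b; do 2!split=> //; case: ab => ab; [right|left] => m am mb.
  (* The intermediate slope [m'] leaves a margin [(m - m') * x], which absorbs the bounded [t - f s]
     once [x] exceeds [- k2 / (m - m')]. *)
  pose m' := (a + m) / 2; have [Pm'|nPm'] := T m'; last first.
    by exfalso; apply: (nPm' 1 ltr01); apply: ab; rewrite /m'; lra.
  have mm' : 0 < m - m' by rewrite /m'; lra.
  exists (Num.max 0 (- k2 / (m - m'))) => x; rewrite gt_max => /andP[x0].
  rewrite ltr_pdivrMr // => xk.
  apply: qallY_notI => //; apply: (qall_up2 rb (Pm' x x0)); first by prove_Def.
  by move=> s t; lra.
pose m' := (m + b) / 2; have [Pm'|nPm'] := T m'.
  by exfalso; apply: (ab m' _ _ (Pm' 1 ltr01)); rewrite /m'; lra.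
have mm' : 0 < m' - m by rewrite /m'; lra.
exists (Num.max 0 (k1 / (m' - m))) => x; rewrite gt_max => /andP[x0].
rewrite ltr_pdivrMr // => xk.
apply: qallY_I => //; apply: (qall_up2 rb (nP _ _ (nPm' x x0))); first by prove_Def.
by move=> s t; lra.
Qed.

(** As [s + x] stays within [b0] of [x], [locally_bounded] keeps [f (s + x)] bounded over [M] for
    large [x], and an infinite [t] decides at once. For bounded [t], the slopes [m] with
    [f u < m * u] for all large [u] form a definable upper set. *)
Lemma decided_bounded b0 B0 : qall (fun s _ => - b0 < s /\ s < b0) ->
  (forall u, B0 < u -> pr u) -> decided W.
Proof.
move=> qs prB.
have [B1 fB1] := locally_bounded omin sat0 df.
have qpr x : B0 + b0 < x -> qall (fun s _ => pr (s + x)).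
  move=> xB; apply: (qall_up qs); first by prove_Def.
  by move=> s _ sb; apply: prB; lra.
have fbd x : B1 + b0 < x ->
    exists k, qall (fun s _ => - k <= f (s + x) /\ f (s + x) <= k).
  move=> xB; have [|k kP] := fB1 (x - b0) (x + b0); first lra.
  exists k; apply: (qall_up qs); first by prove_Def.
  by move=> s _ sb; apply: kP; lra.
pose h0 := Num.max (B0 + b0) (B1 + b0).
have [tP|[tN|[k2 [k1 tb]]]] := qall_bounded (g := fun _ t => t) (DefFun_proj _ _ _).
- apply: (@decidedF _ h0) => x y; rewrite gt_max => /andP[xB /fbd[k kP]].
  apply: qallY_notI; first exact: qpr.
  by apply: (qall_up2 kP (tP (k - y))); [prove_Def|move=> s t; lra].
- apply: (@decidedT _ h0) => x y; rewrite gt_max => /andP[xB /fbd[k kP]].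
  apply: qallY_I; first exact: qpr.
  by apply: (qall_up2 kP (tN (- k - y))); [prove_Def|move=> s t; lra].
pose D m := exists B, forall u, B < u -> f u < m * u.
have [||a [b [Ga [Gb ab]]]] := @gap_upper D.
- by rewrite /D; prove_Def.
- move=> m m' mm' [B BP]; exists (Num.max B 0) => u; rewrite gt_max => /andP[/BP fu u0].
  by apply: (lt_le_trans fu); rewrite ler_pM2r.
have ltab := gap_lt Ga Gb.
have bound m' s : - b0 < s -> s < b0 -> - (`|m'| * b0) <= m' * s <= `|m'| * b0.
  move=> s1 s2; rewrite -ler_norml normrM ler_wpM2l // ler_norml; lra.
exists a, b; do 2!split=> //; case: ab => ab; [right|left] => m am mb.
  pose m' := (a + m) / 2; have [||B BP] := ab m'; try (rewrite /m'; lra).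
  have mm' : 0 < m - m' by rewrite /m'; lra.
  (* The last bound lets the margin [(m - m') * x] absorb both [m' * s] and the lower bound [k2] of
     [t]. *)
  exists (Num.max (B0 + b0) (Num.max (B + b0) ((`|m'| * b0 - k2) / (m - m')))) => x.
  rewrite !gt_max => /and3P[xB0 xB]; rewrite ltr_pdivrMr // => xk.
  apply: qallY_notI; first exact: qpr.
  apply: (qall_up2 tb qs); first by prove_Def.
  move=> s t kt [s1 s2]; have := bound m' s s1 s2.
  have := BP (s + x); rewrite mulrDr; lra.
pose m' := (m + b) / 2.
have [B BP] : exists B, forall u, B < u -> m' * u <= f u.
  have dlt : Def1 S setT (fun u => f u < m' * u) by prove_Def.
  have [B [BD|BD]] := eventually_pinfty omin dlt.
    by exfalso; apply: (ab m'); [rewrite /m'; lra|rewrite /m'; lra|exists B].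
  by exists B => u /BD /negP; rewrite -leNgt.
have mm' : 0 < m' - m by rewrite /m'; lra.
exists (Num.max (B0 + b0) (Num.max (B + b0) ((`|m'| * b0 + k1) / (m' - m)))) => x.
rewrite !gt_max => /and3P[xB0 xB]; rewrite ltr_pdivrMr // => xk.
apply: qallY_I; first exact: qpr.
apply: (qall_up2 tb qs); first by prove_Def.
move=> s t kt [s1 s2]; have := bound m' s s1 s2.
have := BP (s + x); rewrite mulrDr; lra.
Qed.

End lower_fibres.
End type.
End decision.

(** * From lower fibres to arbitrary definable sets *)

Section deciding.
Variables (R : rcfType) (L : language) (S : structure L R).
Hypothesis omin : o_minimal (expansion S).
Hypothesis sat0 : aleph0_saturated (expansion S).
Variables (G : R -> Prop) (gapG : is_gap G).
Variable q : set (set ('I_2 -> R)).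
Hypothesis Uq : is_ultrafilter (definable (expansion S) setT (n := 2)) q.

Local Notation qall := (qall q).

Definition fibre_proper (Y : R -> R -> Prop) u :=
  (exists v, Y u v) /\ (exists v, ~ Y u v).

(** The default 0 at full and empty fibres makes [l] unique for every [u], so this definable
    relation is the graph of the function chosen in [fibre_cut]. *)
Definition is_fibre_cut (Y : R -> R -> Prop) u l :=
  (fibre_proper Y u /\
   ((forall v, v < l -> Y u v) /\ (forall v, l < v -> ~ Y u v))) \/
  (~ fibre_proper Y u /\ l = 0).

Lemma fibre_cut Y : Def2 S setT Y -> (forall u, lower (Y u)) ->
  exists2 f, DefFun1 S setT f & forall u, is_fibre_cut Y u (f u).
Proof.
move=> dY lY; have /choice[f fP] : forall u, exists l, is_fibre_cut Y u l.
  move=> u; have [pu|pu] := lem (fibre_proper Y u); last by exists 0; right.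
  have [[a Ya] [b Yb]] := pu.
  have [|l lP] := lower_cut omin (P := Y u) _ (@lY u) Ya Yb; first by prove_Def.
  by exists l; left.
exists f => //.
have : Def2 S setT (is_fibre_cut Y) by rewrite /is_fibre_cut /fibre_proper; prove_Def.
refine (Def_ext _) => z /=; split=> [|->]; last exact: fP.
have [[pu [l1 l2]]|[pu ->]] := fP (z ord0); last by case=> [[]|[]].
case=> [[_ [h1 h2]]|[]//]; apply: le_anti; apply/andP.
split; rewrite leNgt; apply/negP => h.
  apply: (l2 ((f (z ord0) + z ord_max) / 2)); first lra.
  by apply: h1; lra.
apply: (h2 ((f (z ord0) + z ord_max) / 2)); first lra.
by apply: l1; lra.
Qed.

(** Full and empty fibres have no boundary and are split off. Then an infinite [s] falls under
    [decided_invariant] and a bounded one under [decided_bounded]. *)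
Lemma decided_lower Y : Def2 S setT Y -> (forall u, lower (Y u)) ->
  decided G (fun x y => qall (fun s t => Y (s + x) (t + y))).
Proof.
move=> dY lY; have [f df fP] := fibre_cut dY lY.
pose pr := fibre_proper Y.
have dpr : Def1 S setT pr by rewrite /pr /fibre_proper; prove_Def.
have Yf u : pr u -> (forall v, v < f u -> Y u v) /\ (forall v, f u < v -> ~ Y u v).
  by move=> pu; case: (fP u) => -[].
pose full u := forall v, Y u v.
have dfull : Def1 S setT full by rewrite /full; prove_Def.
pose empty u := forall v, ~ Y u v.
have dempty : Def1 S setT empty by rewrite /empty; prove_Def.
have prE u : ~ full u -> ~ empty u -> pr u.
  move=> nf ne; split; apply: contrapT => h; [apply: ne|apply: nf] => v.
    by move=> Yv; apply: h; exists v.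
  by apply: contrapT => nYv; apply: h; exists v.
have fullW x y : qall (fun s _ => full (s + x)) -> qall (fun s t => Y (s + x) (t + y)).
  by move=> h; apply: (qall_up Uq h); [prove_Def|move=> s t; apply].
have emptyW x y : qall (fun s _ => empty (s + x)) ->
    ~ qall (fun s t => Y (s + x) (t + y)).
  move=> h; apply/(qall_not Uq); first by prove_Def.
  by apply: (qall_up Uq h); [prove_Def|move=> s t; apply].
have inv :
  (forall P x, Def1 S setT P -> qall (fun s _ => P s) -> qall (fun s _ => P (s + x))) ->
  (forall P, Def2 S setT P -> Def1 S setT (fun x => qall (fun s _ => P x s))) ->
  decided G (fun x y => qall (fun s t => Y (s + x) (t + y))).
  move=> shift defq.
  have [qf|qf] := lem (qall (fun s _ => full s)).
    by apply: (@decidedT _ _ gapG _ 0) => x y _; apply: fullW; exact: shift.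
  have [qe|qe] := lem (qall (fun s _ => empty s)).
    by apply: (@decidedF _ _ gapG _ 0) => x y _; apply: emptyW; exact: shift.
  apply: (decided_invariant omin gapG Uq dY df dpr Yf shift defq).
  apply: (qall_up2 Uq ((qall_not Uq _).2 qf) ((qall_not Uq _).2 qe)); try by prove_Def.
  by move=> s _; exact: prE.
(* [nearby] stands for the neighbourhoods of one of the two infinities. By [germ], a definable set
   lies in the type of [s] iff it contains some [nearby B], a condition that is shift-invariant and
   definable in families. *)
have unbounded (nearby : R -> R -> Prop) : Def2 S setT nearby ->
    (forall P, Def1 S setT P -> exists B,
       (forall s, nearby B s -> P s) \/ (forall s, nearby B s -> ~ P s)) ->
    (forall B x s, nearby (B - x) s -> nearby B (s + x)) ->
    (forall B, qall (fun s _ => nearby B s)) ->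
    decided G (fun x y => qall (fun s t => Y (s + x) (t + y))).
  move=> dnear germ near_shift qnear.
  have qE P : Def1 S setT P ->
      qall (fun s _ => P s) <-> exists B, forall s, nearby B s -> P s.
    move=> dP; split=> [qP|[B BP]]; last first.
      by apply: (qall_up Uq (qnear B)); [prove_Def|move=> s _; exact: BP].
    have [B [BP|BP]] := germ _ dP; first by exists B.
    have [s [_ [Ps sB]]] := qall_ex Uq (qallI Uq qP (qnear B)).
    by exfalso; exact: BP Ps.
  apply: inv => [P x dP /(qE _ dP)[B BP]|P dP].
    apply/qE; first by prove_Def.
    by exists (B - x) => s sB; apply: BP; exact: near_shift.
  apply: (@Def_ext _ _ _ _ _ (fun z : 'I_1 -> R =>
    exists B, forall s, nearby B s -> P (z ord0) s)) => [z|].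
    by symmetry; apply: qE; prove_Def.
  by prove_Def.
have [qinf|[qinf|[b1 [b2 qb]]]] :=
  qall_bounded Uq (g := fun s _ => s) (DefFun_proj _ _ _).
- apply: (unbounded (fun B s => B < s)) => //; first by prove_Def.
    by move=> P; exact: eventually_pinfty.
  by move=> B x s; lra.
- apply: (unbounded (fun B s => s < B)) => //; first by prove_Def.
    by move=> P; exact: eventually_ninfty.
  by move=> B x s; lra.
pose b := `|b1| + `|b2| + 1.
have {}qb : qall (fun s _ => - b < s /\ s < b).
  apply: (qall_up Uq qb); first by prove_Def.
  move=> s _; have := ler_norm (- b1); rewrite normrN; have := ler_norm b2.
  by have := normr_ge0 b1; have := normr_ge0 b2; rewrite /b; lra.
have [B [Bf|Bf]] := eventually_pinfty omin dfull.
  apply: (@decidedT _ _ gapG _ (B + b)) => x y xB; apply: fullW.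
  by apply: (qall_up Uq qb); [prove_Def|move=> s _ sb; apply: Bf; lra].
have [B' [Be|Be]] := eventually_pinfty omin dempty.
  apply: (@decidedF _ _ gapG _ (B' + b)) => x y xB; apply: emptyW.
  by apply: (qall_up Uq qb); [prove_Def|move=> s _ sb; apply: Be; lra].
apply: (decided_bounded omin sat0 gapG Uq dY df dpr Yf qb (B0 := Num.max B B')) => u.
by rewrite gt_max => /andP[/Bf nf /Be]; exact: prE.
Qed.

(** [chainE] writes [X] as a finite Boolean combination of chain sets, which have lower fibres. As
    [q] is an ultrafilter, [qall] commutes with Boolean operations, and these preserve
    decidedness. *)
Lemma decided_def X : Def2 S setT X ->
  decided G (fun x y => qall (fun s t => X (s + x) (t + y))).
Proof.
move=> dX; have [K nK] := Def2_bounded_chains omin sat0 dX.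
have XE u v := chainE (u := u) (v := v) (fun b => nK b u v).
pose Z k u v := exists j, (j < k)%N /\
  (chain X true j.+1 u v /\ ~ chain X false j.+1 u v).
suff h k : Def2 S setT (Z k) /\
    decided G (fun x y => qall (fun s t => Z k (s + x) (t + y))).
  suff -> : X = Z K by have [] := h K.
  by apply/funext => u; apply/funext => v; apply/propext; exact: XE.
elim: k => [|k [dZ decZ]].
  split; first by refine (Def_ext (P := fun z => ~ (z ord0 = z ord0)) _ _); [
    by move=> z; split=> // -[j []]|prove_Def].
  apply: (@decidedF _ _ gapG _ 0) => x y _ /(qall_ex Uq) [s [t [j []]]] //.
(* The disjunction is rewritten by negation and conjunction, the operations treated by [decided_not]
   and [decided_and]. *)
have ZS u v : Z k.+1 u v <->
    ~ (~ Z k u v /\ ~ (chain X true k.+1 u v /\ ~ chain X false k.+1 u v)).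
  rewrite not_andE !notK; split=> [[j [jk h]]|[[j [jk h]]|h]].
  - move: jk; rewrite ltnS leq_eqVlt => /orP[/eqP <-|jk]; first by right.
    by left; exists j.
  - by exists j; split=> //; exact: ltnW.
  - by exists k.
have -> : Z k.+1 = (fun u v =>
    ~ (~ Z k u v /\ ~ (chain X true k.+1 u v /\ ~ chain X false k.+1 u v))).
  by apply/funext => u; apply/funext => v; apply/propext.
have dT := Def2_chain true k.+1 dX; have dF := Def2_chain false k.+1 dX.
have decT := decided_lower dT (@chain_lower _ X true k.+1).
have decF := decided_lower dF (@chain_lower _ X false k.+1).
(* As variables, [T] and [F] are not unfolded, and [prove_Def] finds their definability among the
   hypotheses. *)
move: (chain X true k.+1) (chain X false k.+1) dT dF decT decF => T F dT dF decT decF.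
split; first by prove_Def.
have qN P : Def2 S setT P -> decided G (fun x y => qall (fun s t => P (s + x) (t + y))) ->
    decided G (fun x y => qall (fun s t => ~ P (s + x) (t + y))).
  move=> dP /decided_not; congr decided; apply/funext => x; apply/funext => y.
  by apply/propext; symmetry; apply: (qall_not Uq); prove_Def.
have qI P Q : Def2 S setT P -> Def2 S setT Q ->
    decided G (fun x y => qall (fun s t => P (s + x) (t + y))) ->
    decided G (fun x y => qall (fun s t => Q (s + x) (t + y))) ->
    decided G (fun x y => qall (fun s t => P (s + x) (t + y) /\ Q (s + x) (t + y))).
  move=> dP dQ decP decQ; have := decided_and decP decQ.
  congr decided; apply/funext => x; apply/funext => y.
  apply/propext; split=> [[qP qQ]|qPQ]; first exact: (qallI Uq).
  by split; apply: (qall_up Uq qPQ); try (by prove_Def); move=> s t [].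
apply: (qN (fun u v => ~ Z k u v /\ ~ (T u v /\ ~ F u v))); first by prove_Def.
apply: (qI (fun u v => ~ Z k u v) (fun u v => ~ (T u v /\ ~ F u v))); try by prove_Def.
  exact: qN.
apply: (qN (fun u v => T u v /\ ~ F u v)); first by prove_Def.
apply: (qI T (fun u v => ~ F u v)) => //; first by prove_Def.
exact: qN.
Qed.

End deciding.

(** * The two external types *)

Section gap.
Variables (R : rcfType) (L : language) (S : structure L R).

Definition below_nat (x : R) : Prop := exists n : nat, x < n%:R.

(** Saturation provides an element above all naturals. No [l] can be the cut, since adding 1 does
    not leave [below_nat]. *)
Lemma below_nat_gap : aleph0_saturated (expansion S) -> is_gap below_nat.
Proof.
move=> sat0.
have shift x : below_nat x -> below_nat (x + 1).
  by move=> [n xn]; exists n.+1; rewrite -natr1; lra.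
split.
- by move=> x y xy [n yn]; exists n; exact: le_lt_trans yn.
- by exists 0, 1%N.
- have [|||x xP] := @decreasing_realized _ _ _ sat0 set0 1
      (fun n z => n%:R <= z ord0) (finite_set0 _).
  + by move=> n; prove_Def.
  + by move=> i j x ij; apply: le_trans; rewrite ler_nat.
  + by move=> n; exists (fun=> n%:R).
  by exists (x ord0) => -[n]; rewrite ltNge xP.
- move=> l [h1 h2]; have [Gl|nGl] := lem (below_nat l).
    by apply: (h2 (l + 1)); [lra|exact: shift].
  apply: nGl; have -> : l = l - 1 + 1 by lra.
  by apply: shift; apply: h1; lra.
Qed.

End gap.

(** * A slope of [N] inside the gap *)

Section slope.
Variables (R : rcfType) (L : language) (S : structure L R).
Variable N : saturated_extension (expansion S).
Variables (G : R -> Prop) (gapG : is_gap G).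

Definition lt_mul_formula n (y c x : term (oring_ext L) n) : formula (oring_ext L) n :=
  @Atom (oring_ext L) n (inl RLt) (pair2 y (@App (oring_ext L) n (inl FMul) (pair2 c x))).

Definition lt_mul (W : Type) (T : structure (oring_ext L) W) (y c x : W) : Prop :=
  @rint (oring_ext L) W T (inl RLt)
    (pair2 y (@fint (oring_ext L) W T (inl FMul) (pair2 c x))).

Lemma comp_pair2 (U V : Type) (h : U -> V) (u v : U) :
  (fun i => h (pair2 u v i)) = pair2 (h u) (h v).
Proof. by apply/funext => i; rewrite /pair2; case: ifP. Qed.

Lemma sat_lt_mul (W : Type) (T : structure (oring_ext L) W) n
    (y c x : term (oring_ext L) n) (v : 'I_n -> W) :
  sat T (lt_mul_formula y c x) v =
  lt_mul T (Defs.eval T v y) (Defs.eval T v c) (Defs.eval T v x).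
Proof. by rewrite /lt_mul_formula [LHS]/= comp_pair2 /= comp_pair2. Qed.

Lemma lt_mul_emb (y c x : R) :
  lt_mul (ext_str N) (emb N y) (emb N c) (emb N x) <-> y < c * x.
Proof.
pose v : 'I_3 -> R := fun i => nth 0 [:: y; c; x] i.
pose t (i : 'I_3) : term (oring_ext L) 3 := Var i.
have := emb_elementary N (lt_mul_formula (t ord0) (t (inord 1)) (t (inord 2))) v.
by rewrite !sat_lt_mul /= /v !inordK //= => <-.
Qed.

(** Finitely many conditions are met by an element of [G] above the finitely many slopes in [G] that
    occur. Comparing [m * x] with [c * x] in place of [m] with [c] avoids transferring ring laws to
    [N]. *)
Lemma slope_witness : exists c : N, forall x m : R, 0 < x ->
  (lt_mul (ext_str N) (emb N (m * x)) c (emb N x) <-> G m).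
Proof.
pose t (i : 'I_3) : term (oring_ext L) 3 := Var i.
pose phi := lt_mul_formula (t (inord 2)) (t ord0) (t (inord 1)).
pose psi (x m : R) : pformula (oring_ext L) N 1 :=
  @PFormula (oring_ext L) N 1 2 (if `[< G m >] then phi else Neg phi)
    (emb N \o pair2 x (m * x)).
have psiE x m c : psat (ext_str N) (psi x m) c <->
    (lt_mul (ext_str N) (emb N (m * x)) (c ord0) (emb N x) <-> G m).
  have phiE : sat (ext_str N) phi (sapp c (emb N \o pair2 x (m * x))) <->
      lt_mul (ext_str N) (emb N (m * x)) (c ord0) (emb N x).
    rewrite sat_lt_mul /=.
    have -> : inord 2 = rshift 1 (ord_max : 'I_2) by apply/val_inj; rewrite /= inordK.
    have -> : inord 1 = rshift 1 (ord0 : 'I_2) by apply/val_inj; rewrite /= inordK.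
    have -> : (ord0 : 'I_3) = lshift 2 (ord0 : 'I_1) by apply/val_inj.
    by rewrite !sapp_r sapp_l.
  have [h1 h2] := phiE; rewrite /psat /=; case: asboolP => Gm /=.
    by split=> [/h1 //|[_ h]]; apply: h2; exact: h.
  by split=> [nh|h /h1 /h //]; split=> // /h2.
have [|||c cP] := ext_saturated (A := range (emb N)) (n := 1)
  (Gamma := [set f | exists x m, 0 < x /\ f = psi x m]).
- exact: card_image_le.
- by move=> _ [x [m [_ ->]]] i /=; exists (pair2 x (m * x) i).
- move=> k f fP.
  have /choice[xm xmP] : forall i, exists xm : R * R, 0 < xm.1 /\ f i = psi xm.1 xm.2.
    by move=> i; have [x [m h]] := fP i; exists (x, m).
  have [c [Gc cP]] : exists c, G c /\ forall i, G (xm i).2 -> (xm i).2 < c.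
    have [a0 Ga0] := gap_in gapG.
    have [c Gc cP] : exists2 c, G c & forall i, G (xm i).2 -> (xm i).2 <= c.
      exists (\big[Num.max/a0]_(i | `[< G (xm i).2 >]) (xm i).2).
        apply: (big_ind G) => // [x y Gx Gy|i /asboolP //].
        by rewrite /Num.max; case: ifP.
      by move=> i Gi; apply: le_bigmax_cond; apply/asboolP.
    have [c' cc' Gc'] := gap_succ gapG Gc; exists c'; split=> // i /cP; lra.
  exists (fun=> emb N c) => i; have [x0 ->] := xmP i; apply/psiE.
  rewrite lt_mul_emb ltr_pM2r //; split=> [mc|]; last exact: cP.
  by apply: (gap_lower gapG) Gc; exact: ltW.
- exists (c ord0) => x m x0; apply/psiE; apply: cP; by exists x, m.
Qed.

Lemma slope_set : exists2 Z : set ('I_2 -> R), ext_defin N Z &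
  forall x m, 0 < x -> (Z (pair2 x (m * x)) <-> G m).
Proof.
have [c cP] := slope_witness.
pose t (i : 'I_3) : term (oring_ext L) 3 := Var i.
pose phi := lt_mul_formula (t (inord 1)) (t (inord 2)) (t ord0).
pose psi : pformula (oring_ext L) N 2 := @PFormula (oring_ext L) N 2 1 phi (fun=> c).
exists [set g | psat (ext_str N) psi (emb N \o g)].
  by exists [set g | psat (ext_str N) psi g] => //; exists psi.
move=> x m x0; apply: iff_trans (cP x m x0); rewrite /= /psat sat_lt_mul /=.
have -> : inord 1 = lshift 1 (ord_max : 'I_2) by apply/val_inj; rewrite /= inordK.
have -> : inord 2 = rshift 2 (ord0 : 'I_1) by apply/val_inj; rewrite /= inordK.
have -> : (ord0 : 'I_3) = lshift 1 (ord0 : 'I_2) by apply/val_inj.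
rewrite !sapp_l sapp_r; exact: iff_refl.
Qed.

End slope.

(** * Filters of points along slopes near the gap *)

Section filters.
Variable R : rcfType.

(** An iterated limit: first [x] tends to infinity along the line of slope [m], then [m] follows
    [F]. *)
Definition slope_filter (F : set_system R) : set_system ('I_2 -> R) :=
  [set A | F [set m | exists h, forall x, h < x -> A (pair2 x (m * x))]].

Lemma slope_filter_proper F : ProperFilter F -> ProperFilter (slope_filter F).
Proof.
move=> FF; split.
  move=> F0; have [m [h hP]] := @filter_ex _ F FF _ F0; have hh : h < h + 1 by lra.
  exact: (hP _ hh).
split; rewrite /slope_filter /=.
- by apply: (@filterE _ F) => m; exists 0.
- move=> P Q FP FQ; apply: (@filterS2 _ F _ _ _ _ _ FP FQ) => m [h hP] [k kP].
  by exists (Num.max h k) => x; rewrite gt_max => /andP[/hP ? /kP ?].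
- move=> P Q PQ; apply: (@filterS _ F) => m [h hP]; exists h => x /hP; exact: PQ.
Qed.

Variables (G : R -> Prop) (gapG : is_gap G).

Lemma gap_left_filter :
  ProperFilter (filter_from G (fun a => [set m | a < m /\ G m])).
Proof.
apply: filter_from_proper; first apply: filter_from_filter.
- exact: gap_in.
- move=> a b Ga Gb; exists (Num.max a b); first by rewrite /Num.max; case: ifP.
  by move=> m /=; rewrite gt_max => -[/andP[]].
- by move=> a /(gap_succ gapG)[m]; exists m.
Qed.

Lemma gap_right_filter :
  ProperFilter (filter_from (fun b => ~ G b) (fun b => [set m | m < b /\ ~ G m])).
Proof.
apply: filter_from_proper; first apply: filter_from_filter.
- exact: gap_out.
- move=> a b Ga Gb; exists (Num.min a b); first by rewrite /Num.min; case: ifP.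
  by move=> m /=; rewrite lt_min => -[/andP[]].
- by move=> b /(gap_pred gapG)[m]; exists m.
Qed.

End filters.

(** * External types and the map [Lambda] *)

Section Lambda.
Variables (R : rcfType) (L : language) (S : structure L R).
Variable N : saturated_extension (expansion S).

(** Extend [F] to an ultrafilter on all subsets and restrict it to the externally definable ones. *)
Lemma ext_type_of_filter (F : set_system ('I_2 -> R)) : ProperFilter F ->
  exists p : ext_types_G N, forall X, ext_defin N X -> F X -> uset p X.
Proof.
move=> FF; have [U [UU FU]] := ultraFilterLemma FF.
have Up : is_ultrafilter (ext_defin N) [set X | ext_defin N X /\ U X].
  split=> [X []//||[_]|X Y [dX UX] [dY UY]|X Y [dX UX] dY XY|X dX].
  - by split; [exact: ext_defin_setT|exact: filterT].
  - exact: filter_not_empty.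
  - by split; [exact: ext_definI|exact: filterI].
  - by split=> //; exact: filterS UX.
  - have [UX|UX] := in_ultra_setVsetC X UU; [left|right]; split=> //.
    exact: ext_definC.
by exists (Ultra Up) => X dX FX; split=> //; exact: FU.
Qed.

(** At each [q], the preimage of the basic open set of [X] is that of [dset (uset q) X], which is
    externally definable. *)
Lemma Lambda_continuous : continuous (Lambda N).
Proof.
apply: continuous_comp_initial => p.
apply: ptws_cvg => [|q]; first exact: (nbhs_filter p).
apply: ultra_cvg; first exact: (nbhs_filter p).
move=> X [dX pX].
have : nbhs p (ubase (dset (uset q) X)) by apply: nbhs_ubase => //; exact: dset_ext.
by apply: filterS => r rX; split.
Qed.

Lemma Lambda_eq (p p' : ext_types_G N) :
  (forall (q : types_G S) X, defin S X ->
     uset p (dset (uset q) X) <-> uset p' (dset (uset q) X)) ->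
  Lambda N p = Lambda N p'.
Proof.
move=> pp'; have E : ell p = ell p'.
  apply/funext => q; apply: ultra_inj => /=; rewrite eqEsubset.
  by split=> X [dX pX]; split=> //; apply/pp'.
rewrite /Lambda; move: (@ell_ellis_G _ _ _ _ p) (@ell_ellis_G _ _ _ _ p').
by rewrite E => h h'; congr exist; exact: Prop_irrelevance.
Qed.

End Lambda.

Theorem theorem4p2 (R : rcfType) (L : language) (S : structure L R)
    (N : saturated_extension (expansion S)) :
  aleph0_saturated (expansion S) -> o_minimal (expansion S) ->
  continuous (Lambda N) /\
  ~ ellis_isomorphism ext_mul ellis_mul (Lambda N).
Proof.
move=> sat0 omin; split; first exact: Lambda_continuous.
(* Injectivity is what fails: [p1] and [p2] differ on [Z] but have the same image. *)
move=> [/bij_inj Linj _ _].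
have gapG := below_nat_gap sat0; set G := @below_nat R in gapG.
have [Z dZ ZG] := slope_set N gapG.
have pL := slope_filter_proper (gap_left_filter gapG).
have pR := slope_filter_proper (gap_right_filter gapG).
have [p1 p1P] := ext_type_of_filter N pL.
have [p2 p2P] := ext_type_of_filter N pR.
have Z1 : uset p1 Z.
  apply: p1P => //; have [a Ga] := gap_in gapG; exists a => // m [_ Gm].
  by exists 0 => x x0; apply/ZG.
have Z2 : uset p2 (~` Z).
  apply: p2P; first exact: ext_definC.
  have [b Gb] := gap_out gapG; exists b => // m [_ Gm].
  by exists 0 => x x0 /(ZG _ _ x0).
suff p12 : p1 = p2.
  apply: (ultra_set0 (uset_ultra p1)); rewrite -(setICr Z).
  by apply: (ultra_setI (uset_ultra p1)) => //; rewrite p12.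
apply: Linj; apply: Lambda_eq => q X dX.
have dE := dset_ext N q dX.
have Uq := uset_ultra q.
have qE g : dset (uset q) X g <->
    qall (uset q) (fun s t => X (pair2 (s + g ord0) (t + g ord_max))).
  rewrite /dset /qall /= translateE; suff -> : [set x | X (x + g)] =
    [set z | X (pair2 (z ord0 + g ord0) (z ord_max + g ord_max))] by [].
  by apply/funext => z /=; rewrite [z + g]pair2_eta.
(* Hence [dset (uset q) X] or its complement belongs to both slope filters, and so to both [p1] and
   [p2]. *)
have [a [b [Ga [Gb ab]]]] := decided_def omin sat0 gapG Uq (Def2_pair2 dX).
have := uset_ultra p1; have := uset_ultra p2 => U2 U1.
have disj (p : ext_types_G N) : uset p (dset (uset q) X) ->
    uset p (~` dset (uset q) X) -> False.
  move=> h1 h2; apply: (ultra_set0 (uset_ultra p)).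
  by rewrite -(setICr (dset (uset q) X)); exact: (ultra_setI (uset_ultra p)).
(* Each filter bounds [m] by an endpoint on its own side only; the other bound comes from the
   gap. *)
have ltab m : a < m -> G m -> m < b by move=> _ Gm; exact: (gap_lt gapG Gm Gb).
have ltba m : m < b -> ~ G m -> a < m by move=> _ Gm; exact: (gap_lt gapG Ga Gm).
case: ab => ab.
  have h1 : uset p1 (dset (uset q) X).
    apply: p1P => //; exists a => // m [am Gm].
    by have [h hP] := ab m am (ltab m am Gm); exists h => x /hP ?; apply/qE.
  have h2 : uset p2 (dset (uset q) X).
    apply: p2P => //; exists b => // m [mb Gm].
    by have [h hP] := ab m (ltba m mb Gm) mb; exists h => x /hP ?; apply/qE.
  by split.
have h1 : uset p1 (~` dset (uset q) X).
  apply: p1P; first exact: ext_definC.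
  exists a => // m [am Gm].
  by have [h hP] := ab m am (ltab m am Gm); exists h => x /hP nq /qE.
have h2 : uset p2 (~` dset (uset q) X).
  apply: p2P; first exact: ext_definC.
  exists b => // m [mb Gm].
  by have [h hP] := ab m (ltba m mb Gm) mb; exists h => x /hP nq /qE.
by split=> h; exfalso; [exact: disj h h1|exact: disj h h2].
Qed.
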